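(* Let $E\to M$ be a nonzero vector bundle, let $A\subset\mathcal{T}=TM\oplus E$ be a nonzero projective Lie algebroid and $L^A\subset\mathcal{E}=\mathfrak{D}E\oplus\mathfrak{J}E$ its lifted Dirac structure. There is a natural inclusion (a well-defined injective linear map) $$i:\mathrm{Ext}(A)=\mathrm{Der}(A)/\mathrm{Inn}(A)\longrightarrow \mathrm{H}^1(L^A,\rho_{L^A}),\qquad i([\delta])=[\omega_{X_\delta}],\quad\forall\,\delta\in\mathrm{Der}(A),$$ where $X_\delta\in N_{L^A}$ is any element with $(X_\delta)_\bullet|_A=\delta$ (such an element exists) and $\omega_{X}=(X,\cdot)_E:L^A\to E$ for $X\in\Gamma(\mathcal{E})$.
   Context: Omni-Lie algebroid. $\mathfrak{D}E$ is the gauge Lie algebroid of $E$: its sections are the $\mathbb{R}$-linear operators $\mathfrak{d}:\Gamma(E)\to\Gamma(E)$ for which there is a vector field $\alpha(\mathfrak{d})$ with $\mathfrak{d}(fu)=f\mathfrak{d}u+\alpha(\mathfrak{d})(f)u$; the bracket $[\cdot,\cdot]_{\mathfrak{D}}$ is the commutator and the anchor is $\alpha:\mathfrak{D}E\to TM$. (The same notation $\mathfrak{D}V$ is used for any vector bundle $V$.) $\mathfrak{J}E$ is the first jet bundle of $E$ with projection $\mathbf{p}:\mathfrak{J}E\to E$ and $\ker\mathbf{p}=\mathrm{Hom}(TM,E)$. For $u\in\Gamma(E)$, $\mathbf{d}u\in\Gamma(\mathfrak{J}E)$ denotes its first jet; $\mathrm{Hom}(TM,E)$ is embedded so that $\mathbf{d}(fu)=f\,\mathbf{d}u+df\otimes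 u$. There is a nondegenerate $C^\infty(M)$-bilinear $E$-valued pairing with $\langle\mathbf{d}u,\mathfrak{d}\rangle_E=\langle\mathfrak{d},\mathbf{d}u\rangle_E=\mathfrak{d}u$. For $\mathfrak{d}\in\Gamma(\mathfrak{D}E)$ and $\mu\in\Gamma(\mathfrak{J}E)$, the Lie derivative $\mathfrak{L}_{\mathfrak{d}}\mu\in\Gamma(\mathfrak{J}E)$ is defined by $\langle\mathfrak{L}_{\mathfrak{d}}\mu,\mathfrak{d}'\rangle_E=\mathfrak{d}\langle\mu,\mathfrak{d}'\rangle_E-\langle\mu,[\mathfrak{d},\mathfrak{d}']_{\mathfrak{D}}\rangle_E$. On $\mathcal{E}=\mathfrak{D}E\oplus\mathfrak{J}E$ let $\rho:\mathcal{E}\to\mathfrak{D}E$ be the projection, $$\{\mathfrak{d}+\mu,\mathfrak{r}+\nu\}=[\mathfrak{d},\mathfrak{r}]_{\mathfrak{D}}+\mathfrak{L}_{\mathfrak{d}}\nu-\mathfrak{L}_{\mathfrak{r}}\mu+\mathbf{d}\langle\mu,\mathfrak{r}\rangle_E,\qquad (\mathfrak{d}+\mu,\mathfrak{r}+\nu)_E=\tfrac12(\langle\mathfrak{d},\nu\rangle_E+\langle\mathfrak{r},\mu\rangle_E).$$ The bundle map $\mathbf{b}:\mathcal{E}\to\mathcal{T}$ is $\mathbf{b}(\mathfrak{d}+\mu)=\alpha(\mathfrak{d})+\mathbf{p}(\mu)$. For a subbundle $S\subset\mathcal{E}$, $S^\perp=\{X\in\mathcal{E}: (X,s)_E=0\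 \forall s\in S\}$. A Dirac structure is a subbundle $L$ that is maximal isotropic (equivalently $L=L^\perp$) with $\{\Gamma(L),\Gamma(L)\}\subset\Gamma(L)$; it is a Lie algebroid with the restricted bracket and anchor $\alpha\circ\rho$, and $\rho_L=\rho|_L:L\to\mathfrak{D}E$ is a representation of $L$ on $E$. $d_L$ is the Lie algebroid coboundary operator on $\Gamma(\mathrm{Hom}(\wedge^\bullet L,E))$ of this representation, and $\mathrm{H}^\bullet(L,\rho_L)$ its cohomology. $L$ is reducible if $\mathbf{b}(L)$ has constant rank. A projective Lie algebroid is a subbundle $A\subset TM\oplus E$ with a Lie algebroid structure $(A,[\cdot,\cdot]_A,\rho_A)$ whose anchor is $\rho_A=pr_{TM}|_A$. Its lifted Dirac structure $L^A$ is the unique reducible Dirac structure $L\subset\mathcal{E}$ with $\mathbf{b}(L)=A$ and $\mathbf{b}\{X,Y\}=[\mathbf{b}X,\mathbf{b}Y]_A$ for all $X,Y\in\Gamma(L)$ (it exists). The normalizer of a subbundle $C\subset\mathcal{E}$ is $N_C=\{X\in\Gamma(\mathcal{E}): \{X,Y\}\in\Gamma(C)\ \forall\, Y\in\Gamma(C)\}$. The falling operator $(\cdot)_\bullet:\Gamma(\mathcal{E})\to\Gamma(\mathfrak{D}\mathcal{T})$ is $X_\bullet(t)=\mathbf{b}\{X,Y\}$ for $t\in\Gamma(\mathcal{T})$ and any $Y\in\Gamma(\mathcal{E})$ with $\mathbf{b}(Y)=t$ (well defined). $X_\bullet|_A$ is its restriction to $\Gamma(A)$. $\mathrm{Der}(A)$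 is the set of $\delta\in\Gamma(\mathfrak{D}A)$ with $\delta[a_1,a_2]_A=[\delta a_1,a_2]_A+[a_1,\delta a_2]_A$ for all $a_1,a_2\in\Gamma(A)$; $\mathrm{Inn}(A)=\{[a,\cdot]_A: a\in\Gamma(A)\}$. *)

(* Defs.v *)
From HB Require Import structures.
From mathcomp Require Import all_boot all_order all_algebra.
From mathcomp Require Import mathcomp_extra boolp classical_sets functions cardinality reals.
From mathcomp Require Import topology normedtype landau derive.
From mathcomp Require Import ring_quotient generic_quotient ring.
Import Order.TTheory GRing.Theory Num.Theory.
Import numFieldNormedType.Exports.
Set Implicit Arguments.
Unset Strict Implicit.
Unset Printing Implicit Defensive.
Local Open Scope classical_set_scope.
Local Open Scope ring_scope.
Section calculus.
Context {R : realType} {n : nat}.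
Implicit Types (f g : 'rV[R]_n -> R^o) (x : 'rV[R]_n).

(* f is of class C^k at x, through the iterated partial derivatives of f; *)
(* being C^k at every point of an open set is the usual C^k on that set. *)
Fixpoint Ck_at (k : nat) (f : 'rV[R]_n -> R^o) (x : 'rV[R]_n) : Prop :=
  if k is k'.+1 then
    (\forall y \near x, differentiable f y) /\
    forall i : 'I_n, Ck_at k' (fun y => 'D_(delta_mx 0 i) f y) x
  else {for x, continuous f}.

Definition smooth_at f x := forall k, Ck_at k f x.

Lemma differentiable_ext f g x :
  (\forall y \near x, f y = g y) -> differentiable f x -> differentiable g x.
Proof.
move=> fg df.
have H : g \o shift x = cst (g x) + 'd f x +o_ (0 : 'rV[R]_n) id.
  apply/eqaddoP => e e0.
  have /eqaddoP/(_ e e0) := diff_locally df.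
  move: (fg); rewrite (near_shift 0) subr0; apply: filterS2 => h /= fgh.
  rewrite !fctE /= in fgh *.
  by rewrite /= fgh (nbhs_singleton fg).
have dc : continuous ('d f x) by have /diff_locallyP[] := df.
apply/diff_locallyP; rewrite (diff_unique dc H); split=> [|]; [exact: dc|exact: H].
Qed.

Lemma Ck_ext k f g x :
  (\forall y \near x, f y = g y) -> Ck_at k f x -> Ck_at k g x.
Proof.
elim: k f g => [|k IH] f g /= fg.
  rewrite /prop_for /continuous_at -(nbhs_singleton fg) => fc.
  exact: (cvg_trans (@near_eq_cvg _ _ (nbhs x) _ f g fg) fc).
have fg2 := near_join fg.
case=> df Df; split=> [|i].
  by apply: filterS2 df fg2 => y dfy fgy; exact: differentiable_ext fgy dfy.
apply: IH (Df i).
by apply: filterS fg2 => y; exact: near_eq_derive.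
Qed.

Lemma Ck_cst k (a : R^o) x : Ck_at k (fun=> a) x.
Proof.
elim: k a => [|k IH] a /=; first exact: cst_continuous.
split; first by apply: (@nearW _ (nbhs x)) => y; exact: differentiable_cst.
move=> i; suff -> : (fun y => 'D_(delta_mx 0 i) (fun=> a) y) =
   (fun=> 0) :> ('rV[R]_n -> R^o) by exact: IH.
by apply/funext => y; exact: (derive_cst a).
Qed.

Lemma Ck_S k f x : Ck_at k.+1 f x -> Ck_at k f x.
Proof.
elim: k f => [|k IH] f [df Df].
  exact: differentiable_continuous (nbhs_singleton df).
by split=> // i; exact: IH.
Qed.

Lemma CkD k f g x : Ck_at k f x -> Ck_at k g x ->
  Ck_at k (fun y => f y + g y) x.
Proof.
elim: k f g => [|k IH] f g; first by move=> cf cg; exact: (cvgD cf cg).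
move=> [df Df] [dg Dg]; split=> [|i].
  by apply: filterS2 df dg => y; exact: differentiableD.
apply: Ck_ext (IH _ _ (Df i) (Dg i)).
apply: filterS2 df dg => y dfy dgy.
by rewrite -deriveD //; exact: diff_derivable.
Qed.

Lemma CkM k f g x : Ck_at k f x -> Ck_at k g x ->
  Ck_at k (fun y => f y * g y) x.
Proof.
elim: k f g => [|k IH] f g; first by move=> cf cg; exact: (cvgM cf cg).
move=> fk gk; have [df Df] := fk; have [dg Dg] := gk; split=> [|i].
  by apply: filterS2 df dg => y; exact: differentiableM.
apply: (@Ck_ext _ (fun y => f y * 'D_(delta_mx 0 i) g y
   + g y * 'D_(delta_mx 0 i) f y)).
  apply: filterS2 df dg => y dfy dgy.
  by apply/esym; apply: (@deriveM _ _ (f : _ -> R) (g : _ -> R)); exact: diff_derivable.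
by apply: CkD; apply: IH; [exact: Ck_S fk | exact: Dg | exact: Ck_S gk | exact: Df].
Qed.

End calculus.

Section linear.
Context {R : realType}.

Record subspace (V : lmodType R) := Subspace {
  subspace_set :> V -> Prop;
  subspace0 : subspace_set 0;
  subspaceD : forall u v, subspace_set u -> subspace_set v ->
    subspace_set (u + v);
  subspaceZ : forall (a : R) u, subspace_set u -> subspace_set (a *: u) }.

Definition subspace_pred (V : lmodType R) (W : subspace V) : {pred V} :=
  [pred v | `[< W v >]].

Lemma subspace_predP (V : lmodType R) (W : subspace V) v :
  reflect (W v) (v \in subspace_pred W).
Proof. exact: asboolP. Qed.

Lemma subspace_closed (V : lmodType R) (W : subspace V) :
  submod_closed (subspace_pred W).
Proof.
split=> [|a u v]; first by apply/subspace_predP; exact: subspace0.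
move=> /subspace_predP Wu /subspace_predP Wv; apply/subspace_predP.
by apply: subspaceD => //; exact: subspaceZ.
Qed.

HB.instance Definition _ (V : lmodType R) (W : subspace V) :=
  GRing.isSubmodClosed.Build R V (subspace_pred W) (subspace_closed W).

(* linear span, as the intersection of all subspaces containing S *)
Definition lspan (V : lmodType R) (S : set V) : set V :=
  [set v | forall W : subspace V, S `<=` W -> W v].
Fact lspan0 (V : lmodType R) (S : set V) : lspan S 0.
Proof. by move=> W _; exact: subspace0. Qed.
Fact lspanD (V : lmodType R) (S : set V) u v : lspan S u -> lspan S v -> lspan S (u + v).
Proof. by move=> Su Sv W SW; apply: subspaceD; [exact: Su|exact: Sv]. Qed.
Fact lspanZ (V : lmodType R) (S : set V) (a : R) u : lspan S u -> lspan S (a *: u).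
Proof. by move=> Su W SW; apply: subspaceZ; exact: Su. Qed.
Definition lspan_subspace (V : lmodType R) (S : set V) : subspace V :=
  Subspace (@lspan0 V S) (@lspanD V S) (@lspanZ V S).

Record subspace_type (V : lmodType R) (W : subspace V) := SubElt {
  sval_of :> V;
  sval_ofP : sval_of \in subspace_pred W }.

HB.instance Definition _ (V : lmodType R) (W : subspace V) :=
  [isSub for @sval_of V W].
HB.instance Definition _ (V : lmodType R) (W : subspace V) :=
  [Choice of subspace_type W by <:].
HB.instance Definition _ (V : lmodType R) (W : subspace V) :=
  [SubChoice_isSubLmodule of subspace_type W by <:].

Definition subelt (V : lmodType R) (W : subspace V) (v : V) (h : W v) :
  subspace_type W := SubElt (asboolT h).

Definition quot_space (V : lmodType R) (W : subspace V) : Type :=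
  (Quotient.quot (subspace_pred W)).

Section quotient_lmod.
Variables (V : lmodType R) (W : subspace V).
Local Open Scope quotient_scope.
Local Notation Q := (quot_space W).
HB.instance Definition _ := GRing.Zmodule.on Q.
Definition qproj (v : V) : Q := \pi_(Quotient.quot (subspace_pred W))%type v.
Definition qrepr (q : Q) : V := repr (q : (Quotient.quot (subspace_pred W))).
Lemma qreprK : cancel qrepr qproj. Proof. exact: reprK. Qed.
Lemma qproj_eq u v : qproj u = qproj v <-> W (u - v).
Proof.
split=> [/eqP|h]; last apply/eqP.
  by rewrite -Quotient.idealrBE => /subspace_predP.
by rewrite -Quotient.idealrBE; apply/subspace_predP.
Qed.
Lemma qprojD u v : qproj (u + v) = qproj u + qproj v.
Proof. exact: Quotient.pi_add. Qed.
Definition qscale (a : R) (q : Q) : Q := qproj (a *: qrepr q).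
Lemma qprojZ a v : qproj (a *: v) = qscale a (qproj v).
Proof.
apply/qproj_eq; rewrite -scalerBr; apply: subspaceZ.
by apply/qproj_eq; rewrite qreprK.
Qed.
Fact qscaleA a b q : qscale a (qscale b q) = qscale (a * b) q.
Proof. by rewrite -(qreprK q) -!qprojZ scalerA. Qed.
Fact qscale1 : left_id 1 qscale.
Proof. by move=> q; rewrite -(qreprK q) -!qprojZ scale1r. Qed.
Fact qscaleDr : right_distributive qscale +%R.
Proof.
move=> a q r; rewrite -(qreprK q) -(qreprK r) -qprojD -!qprojZ.
by rewrite scalerDr qprojD.
Qed.
Fact qscaleDl q : {morph qscale^~ q : a b / a + b}.
Proof. by move=> a b /=; rewrite -(qreprK q) -!qprojZ scalerDl qprojD. Qed.
HB.instance Definition _ := GRing.Zmodule_isLmodule.Build R Q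
  qscaleA qscale1 qscaleDr qscaleDl.

End quotient_lmod.

Definition fam (T : Type) (V : T -> lmodType R) : Type := forall x, V x.

Section fam_lmod.
Variables (T : Type) (V : T -> lmodType R).
Implicit Types s t u : fam V.
HB.instance Definition _ := Choice.copy (fam V) (forall x, V x).
Definition fam0 : fam V := fun _ => 0.
Definition fam_opp s : fam V := fun x => - s x.
Definition fam_add s t : fam V := fun x => s x + t x.
Definition fam_scale (a : R) s : fam V := fun x => a *: s x.
Let famE s t : (forall x, s x = t x) -> s = t.
Proof. exact: functional_extensionality_dep. Qed.
Fact fam_addA : associative fam_add.
Proof. by move=> s t u; apply: famE => x; rewrite /fam_add addrA. Qed.
Fact fam_addC : commutative fam_add.
Proof. by move=> s t; apply: famE => x; rewrite /fam_add addrC. Qed.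
Fact fam_add0 : left_id fam0 fam_add.
Proof. by move=> s; apply: famE => x; rewrite /fam_add add0r. Qed.
Fact fam_addN : left_inverse fam0 fam_opp fam_add.
Proof. by move=> s; apply: famE => x; rewrite /fam_add addNr. Qed.
HB.instance Definition _ :=
  GRing.isZmodule.Build (fam V) fam_addA fam_addC fam_add0 fam_addN.
Fact fam_scaleA a b s : fam_scale a (fam_scale b s) = fam_scale (a * b) s.
Proof. by apply: famE => x; rewrite /fam_scale scalerA. Qed.
Fact fam_scale1 : left_id 1 fam_scale.
Proof. by move=> s; apply: famE => x; rewrite /fam_scale scale1r. Qed.
Fact fam_scaleDr : right_distributive fam_scale +%R.
Proof. by move=> a s t; apply: famE => x; rewrite /fam_scale scalerDr. Qed.
Fact fam_scaleDl s : {morph fam_scale^~ s : a b / a + b}.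
Proof. by move=> a b; apply: famE => x; rewrite /fam_scale scalerDl. Qed.
HB.instance Definition _ := GRing.Zmodule_isLmodule.Build R (fam V)
  fam_scaleA fam_scale1 fam_scaleDr fam_scaleDl.
End fam_lmod.

End linear.

Section manifolds.
Context {R : realType}.

(* cmap and cinv are total functions; only their values on cdom and ccod *)
(* are constrained, hence meaningful. *)
Record chart (T : topologicalType) (n : nat) := Chart {
  cdom : set T;
  ccod : set 'rV[R]_n;
  cmap : T -> 'rV[R]_n;
  cinv : 'rV[R]_n -> T;
  cdom_open : open cdom;
  ccod_open : open ccod;
  cmap_cod : forall x, cdom x -> ccod (cmap x);
  cinv_dom : forall y, ccod y -> cdom (cinv y);
  cmapK : forall x, cdom x -> cinv (cmap x) = x;
  cinvK : forall y, ccod y -> cmap (cinv y) = y;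
  cmap_continuous : forall x, cdom x -> {for x, continuous cmap};
  cinv_continuous : forall y, ccod y -> {for y, continuous cinv} }.

(* smooth manifolds of constant dimension n, without boundary *)
Record manifold (n : nat) := Manifold {
  mspace :> topologicalType;
  mspace_hausdorff : hausdorff_space mspace;
  mspace_second_countable : @second_countable mspace;
  atlas : set (chart mspace n);
  atlas_cover : forall x, exists2 c, atlas c & cdom c x;
  atlas_smooth : forall c c', atlas c -> atlas c' ->
    forall y, ccod c y -> cdom c' (cinv c y) ->
    forall j : 'I_n, smooth_at (fun z => cmap c' (cinv c z) 0 j) y }.

Definition smooth_on n (M : manifold n) (U : set M) (f : M -> R^o) :=
  forall c, atlas c -> forall y, ccod c y -> U (cinv c y) ->
    smooth_at (f \o cinv c) y.

Section smooth_functions.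
Variables (n : nat) (M : manifold n).
Implicit Types (U : set M) (f g : M -> R^o).

Lemma smooth_on_cst U (a : R^o) : smooth_on U (fun=> a).
Proof. by move=> c _ y _ _ k; exact: Ck_cst. Qed.

Lemma smooth_onD U f g : smooth_on U f -> smooth_on U g ->
  smooth_on U (fun x => f x + g x).
Proof. by move=> Uf Ug c cA y cy Uy k; apply: CkD; [exact: Uf|exact: Ug]. Qed.

Lemma smooth_onM U f g : smooth_on U f -> smooth_on U g ->
  smooth_on U (fun x => f x * g x).
Proof. by move=> Uf Ug c cA y cy Uy k; apply: CkM; [exact: Uf|exact: Ug]. Qed.

Lemma smooth_onS U U' f : U' `<=` U -> smooth_on U f -> smooth_on U' f.
Proof. by move=> UU Uf c cA y cy Uy; apply: Uf => //; exact: UU. Qed.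

Lemma smooth_on_local U f :
  (forall x, U x -> exists V g,
    [/\ open V, V x, smooth_on V g & forall y, V y -> f y = g y]) ->
  smooth_on U f.
Proof.
move=> H c cA y cy Uy k.
have [V [g [oV Vy sg fg]]] := H _ Uy.
apply: (@Ck_ext _ _ k (g \o cinv c)); last by apply: sg.
have nV : \forall z \near y, V (cinv c z).
  exact: (cinv_continuous cy (open_nbhs_nbhs (conj oV Vy))).
by apply: (@filterS _ (nbhs y) _ _ _ _ nV) => z Vz; rewrite /= fg.
Qed.

Fact cinf_subproof0 : smooth_on setT (0 : M -> R^o).
Proof. exact: smooth_on_cst. Qed.
Fact cinf_subproofZ (a : R) f : smooth_on setT f -> smooth_on setT (a *: f).
Proof. by move=> sf; apply: smooth_onM => //; exact: smooth_on_cst. Qed.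

Definition cinf_subspace : subspace (M -> R^o) :=
  Subspace cinf_subproof0 (@smooth_onD setT) cinf_subproofZ.
Definition cinf : Type := subspace_type cinf_subspace.
HB.instance Definition _ := GRing.Lmodule.on cinf.
Definition cinf_fun (f : cinf) : M -> R^o := sval_of f.
Coercion cinf_fun : cinf >-> Funclass.

Lemma cinf_smooth (f : cinf) : smooth_on setT f.
Proof. by case: f => f /= /subspace_predP. Qed.

Definition cmul (f g : cinf) : cinf :=
  subelt (W := cinf_subspace) (smooth_onM (cinf_smooth f) (cinf_smooth g)).

End smooth_functions.

Section bundles.
Variables (n : nat) (M : manifold n).

(* A family of real vector spaces over M together with the sheaf of its smooth
   local sections: smooth_sec U s says that the family s is smooth on U (values
   outside U are irrelevant).  Only open sets U are ever used.  Local triviality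
   is not part of this interface: TM, DE, JE and their sums are given through
   fibres and smooth sections only, whereas E itself is a vector_bundle. *)
Record bundle := Bundle {
  fib :> M -> lmodType R;
  smooth_sec : set M -> fam fib -> Prop;
  smooth_sec0 : forall U, smooth_sec U 0;
  smooth_secD : forall U s t, smooth_sec U s -> smooth_sec U t ->
    smooth_sec U (s + t);
  smooth_secZ : forall U (f : M -> R^o) s, open U -> smooth_on U f -> smooth_sec U s ->
    smooth_sec U (fun x => f x *: s x);
  smooth_secS : forall U U' s, U' `<=` U -> smooth_sec U s -> smooth_sec U' s;
  smooth_sec_local : forall U s,
    (forall x, U x -> exists V t,
      [/\ open V, V x, smooth_sec V t & forall y, V y -> s y = t y]) ->
    smooth_sec U s }.

Section sections.
Variable V : bundle.

Fact gamma_subproofZ (a : R) (s : fam V) :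
  smooth_sec setT s -> smooth_sec setT (a *: s).
Proof. by move=> ss; apply: smooth_secZ => //; [exact: openT|exact: smooth_on_cst]. Qed.

Definition gamma_subspace : subspace (fam V) :=
  Subspace (smooth_sec0 V setT) (@smooth_secD V setT) gamma_subproofZ.
Definition gamma : Type := subspace_type gamma_subspace.
HB.instance Definition _ := GRing.Lmodule.on gamma.
Definition gamma_fun (s : gamma) : forall x, V x := sval_of s.
Coercion gamma_fun : gamma >-> Funclass.

Lemma gamma_smooth (s : gamma) : smooth_sec setT (gamma_fun s).
Proof. by case: s => s /= /subspace_predP. Qed.

Definition to_gamma (s : fam V) (h : smooth_sec setT s) : gamma :=
  subelt (W := gamma_subspace) h.

Lemma gammaP (s t : gamma) : (forall x, s x = t x) -> s = t.
Proof. by move=> st; apply: val_inj; exact: functional_extensionality_dep. Qed.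

End sections.

Section scaling.
Variable V : bundle.

Definition gscale (f : cinf M) (s : gamma V) : gamma V :=
  to_gamma (smooth_secZ openT (cinf_smooth f) (gamma_smooth s)).

Definition is_basis r (W : lmodType R) (e : 'I_r -> W) (S : set W) :=
  (forall i, S (e i)) /\
  forall w, S w -> exists! a : 'I_r -> R, w = \sum_i a i *: e i.

(* subbundles of constant rank r: locally spanned by smooth frames *)
Record subbundle (r : nat) := Subbundle {
  sfib :> forall x, subspace (V x);
  sfib_frame : forall x0, exists U (e : 'I_r -> fam V),
    [/\ open U, U x0, forall i, smooth_sec U (e i) &
        forall x, U x -> is_basis (fun i => e i x) (sfib x)] }.

Section subsections.
Variables (r : nat) (W : subbundle r).
Fact sgamma_subproof0 x : W x ((0 : gamma V) x).
Proof. exact: subspace0. Qed.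
Fact sgamma_subproofD (s t : gamma V) :
  (forall x, W x (s x)) -> (forall x, W x (t x)) -> forall x, W x ((s + t : gamma V) x).
Proof. by move=> Ws Wt x; apply: subspaceD. Qed.
Fact sgamma_subproofZ (a : R) (s : gamma V) :
  (forall x, W x (s x)) -> forall x, W x ((a *: s : gamma V) x).
Proof. by move=> Ws x; apply: subspaceZ. Qed.

Definition sgamma_subspace : subspace (gamma V) :=
  Subspace sgamma_subproof0 sgamma_subproofD sgamma_subproofZ.
Definition sgamma : Type := subspace_type sgamma_subspace.
HB.instance Definition _ := GRing.Lmodule.on sgamma.
Definition sgamma_val (s : sgamma) : gamma V := sval_of s.
Coercion sgamma_val : sgamma >-> gamma.

Lemma sgamma_in (s : sgamma) x : W x (s x).
Proof. by case: s => s /= /subspace_predP. Qed.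

Definition to_sgamma (s : gamma V) (h : forall x, W x (s x)) : sgamma :=
  subelt (W := sgamma_subspace) h.

Fact sgscale_subproof (f : cinf M) (s : sgamma) x : W x (gscale f s x).
Proof. by apply: subspaceZ; exact: sgamma_in. Qed.
Definition sgscale (f : cinf M) (s : sgamma) : sgamma :=
  to_sgamma (sgscale_subproof f s).
End subsections.
End scaling.

Section direct_sum.
Variables V1 V2 : bundle.

Definition bsum_smooth (U : set M) (s : fam (fun x => (V1 x * V2 x)%type)) :=
  smooth_sec U (fun x => (s x).1) /\ smooth_sec U (fun x => (s x).2).

Fact bsum0 U : bsum_smooth U 0.
Proof. by split; exact: smooth_sec0. Qed.
Fact bsumD U s t : bsum_smooth U s -> bsum_smooth U t -> bsum_smooth U (s + t).
Proof. by move=> [s1 s2] [t1 t2]; split; exact: smooth_secD. Qed.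
Fact bsumZ U (f : M -> R^o) s : open U -> smooth_on U f -> bsum_smooth U s ->
  bsum_smooth U (fun x => f x *: s x).
Proof. by move=> oU sf [s1 s2]; split; exact: smooth_secZ. Qed.
Fact bsumS U U' s : U' `<=` U -> bsum_smooth U s -> bsum_smooth U' s.
Proof. by move=> UU [s1 s2]; split; apply: smooth_secS UU _. Qed.
Fact bsum_local U s :
  (forall x, U x -> exists V t,
    [/\ open V, V x, bsum_smooth V t & forall y, V y -> s y = t y]) ->
  bsum_smooth U s.
Proof.
move=> H; split; apply: smooth_sec_local => x /H[V [t [oV Vx [t1 t2] st]]].
- by exists V, (fun x => (t x).1); split=> // y /st ->.
- by exists V, (fun x => (t x).2); split=> // y /st ->.
Qed.
Definition bsum : bundle := Bundle bsum0 bsumD bsumZ bsumS bsum_local.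

Fact gfst_subproof (s : gamma bsum) : smooth_sec setT (fun x => (s x).1).
Proof. by case: (gamma_smooth s). Qed.
Fact gsnd_subproof (s : gamma bsum) : smooth_sec setT (fun x => (s x).2).
Proof. by case: (gamma_smooth s). Qed.
Definition gfst (s : gamma bsum) : gamma V1 := to_gamma (gfst_subproof s).
Definition gsnd (s : gamma bsum) : gamma V2 := to_gamma (gsnd_subproof s).

Fact gpair_subproof (s : gamma V1) (t : gamma V2) :
  smooth_sec (b := bsum) setT (fun x => (s x, t x)).
Proof. by split; exact: gamma_smooth. Qed.
Definition gpair (s : gamma V1) (t : gamma V2) : gamma bsum :=
  to_gamma (gpair_subproof s t).
End direct_sum.

Section tangent_bundle.
Implicit Types (f g : cinf M).

(* T_x M as the space of derivations of C^oo(M) at x *)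
Definition is_derivation (x : M) (v : cinf M -> R^o) :=
  (forall (a : R) f g, v (a *: f + g) = a * v f + v g) /\
  (forall f g, v (cmul f g) = f x * v g + g x * v f).

Fact tangent0 x : is_derivation x 0.
Proof. by split=> *; rewrite /= ?mulr0 ?addr0. Qed.
Fact tangentD x v w : is_derivation x v -> is_derivation x w ->
  is_derivation x (v + w).
Proof.
move=> [v1 v2] [w1 w2]; split=> [a f g|f g]; rewrite !fctE.
- by rewrite v1 w1 mulrDr addrACA.
- by rewrite v2 w2 !mulrDr addrACA.
Qed.
Fact tangentZ x (a : R) v : is_derivation x v -> is_derivation x (a *: v).
Proof.
move=> [v1 v2]; split=> [b f g|f g]; rewrite !fctE.
- by rewrite v1 scalerDr; congr (_ + _); rewrite /GRing.scale /= mulrCA.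
- by rewrite v2 scalerDr; congr (_ + _); rewrite /GRing.scale /= mulrCA.
Qed.
Definition tangent_subspace (x : M) : subspace (cinf M -> R^o) :=
  Subspace (tangent0 x) (@tangentD x) (@tangentZ x).
Definition tangent (x : M) : Type := subspace_type (tangent_subspace x).
HB.instance Definition _ x := GRing.Lmodule.on (tangent x).
Definition tangent_fun x (v : tangent x) : cinf M -> R^o := sval_of v.
Coercion tangent_fun : tangent >-> Funclass.

Lemma tangent_lin x (v : tangent x) (a : R) f g :
  v (a *: f + g) = a * v f + v g.
Proof. by case: v => v /= /subspace_predP[+ _]; apply. Qed.
Lemma tangent_leibniz x (v : tangent x) f g :
  v (cmul f g) = f x * v g + g x * v f.
Proof. by case: v => v /= /subspace_predP[_]; apply. Qed.

Definition tangent_smooth (U : set M) (X : fam tangent) :=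
  forall f, smooth_on U (fun x => (X x : tangent x) f).
Fact tangent_smooth0 U : tangent_smooth U 0.
Proof. by move=> f; exact: smooth_on_cst. Qed.
Fact tangent_smoothD U X Y : tangent_smooth U X -> tangent_smooth U Y ->
  tangent_smooth U (X + Y).
Proof. by move=> sX sY f; exact: (smooth_onD (sX f) (sY f)). Qed.
Fact tangent_smoothZ U (h : M -> R^o) X : open U -> smooth_on U h ->
  tangent_smooth U X ->
  tangent_smooth U (fun x => h x *: X x).
Proof. by move=> _ sh sX f; exact: (smooth_onM sh (sX f)). Qed.
Fact tangent_smoothS U U' X : U' `<=` U -> tangent_smooth U X ->
  tangent_smooth U' X.
Proof. by move=> UU sX f; exact: (smooth_onS UU (sX f)). Qed.
Fact tangent_smooth_local U X :
  (forall x, U x -> exists V Y,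
    [/\ open V, V x, tangent_smooth V Y & forall y, V y -> X y = Y y]) ->
  tangent_smooth U X.
Proof.
move=> H f; apply: smooth_on_local => x /H[V [Y [oV Vx sY XY]]].
by exists V, (fun x => (Y x : tangent x) f); split=> // y /XY ->.
Qed.
Definition tangent_bundle : bundle :=
  Bundle tangent_smooth0 tangent_smoothD tangent_smoothZ tangent_smoothS
         tangent_smooth_local.

Definition vact (X : gamma tangent_bundle) f : cinf M :=
  subelt (W := cinf_subspace M) (gamma_smooth X f).
End tangent_bundle.

Section gauge.
Variable E : bundle.
Implicit Types (u : gamma E) (f : cinf M).

(* The fibre of DE at x: operators Gamma(E) -> E_x with their symbol.  The
   symbol is recorded along with the operator, which determines it as soon as
   E_x is nonzero. *)
Definition is_gauge (x : M) (d : (gamma E -> E x) * tangent x) :=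
  (forall (a : R) u v, d.1 (a *: u + v) = a *: d.1 u + d.1 v) /\
  (forall f u, d.1 (gscale f u) = f x *: d.1 u + (d.2 f) *: u x).

Fact gauge0 x : @is_gauge x 0.
Proof.
split=> [a u v|f u] /=; first by rewrite scaler0 addr0.
by rewrite scaler0 [X in X *: _](_ : _ = 0) // scale0r addr0.
Qed.
Fact gaugeD x c d : @is_gauge x c -> is_gauge d -> is_gauge (c + d).
Proof.
have E1 u : (c + d).1 u = c.1 u + d.1 u by [].
have E2 f : ((c + d).2 : tangent x) f = c.2 f + d.2 f by [].
move=> [c1 c2] [d1 d2]; split=> [a u v|f u].
- by rewrite !E1 c1 d1 scalerDr addrACA.
- by rewrite !E1 E2 c2 d2 scalerDr scalerDl addrACA.
Qed.
Fact gaugeZ x (a : R) d : @is_gauge x d -> is_gauge (a *: d).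
Proof.
have E1 u : (a *: d).1 u = a *: d.1 u by [].
have E2 f : ((a *: d).2 : tangent x) f = a * d.2 f by [].
move=> [d1 d2]; split=> [b u v|f u].
- by rewrite !E1 d1 scalerDr !scalerA mulrC.
- by rewrite !E1 E2 d2 scalerDr !scalerA mulrC.
Qed.
Definition gauge_subspace (x : M) :
    subspace ((gamma E -> E x) * tangent x)%type :=
  Subspace (gauge0 x) (@gaugeD x) (@gaugeZ x).
Definition gauge (x : M) : Type := subspace_type (gauge_subspace x).
HB.instance Definition _ x := GRing.Lmodule.on (gauge x).
Definition gauge_op x (d : gauge x) : gamma E -> E x := (sval_of d).1.
Coercion gauge_op : gauge >-> Funclass.
Definition gauge_symbol x (d : gauge x) : tangent x := (sval_of d).2.

Lemma gauge_lin x (d : gauge x) (a : R) u v :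
  d (a *: u + v) = a *: d u + d v.
Proof. by have /subspace_predP[h _] := sval_ofP d; exact: h. Qed.
Lemma gauge_leibniz x (d : gauge x) f u :
  d (gscale f u) = f x *: d u + gauge_symbol d f *: u x.
Proof. by have /subspace_predP[_ h] := sval_ofP d; exact: h. Qed.
Lemma gauge_opD x (d : gauge x) u v : d (u + v) = d u + d v.
Proof. by rewrite -[u in LHS]scale1r gauge_lin scale1r. Qed.
Lemma gauge_op0 x (d : gauge x) : d 0 = 0.
Proof. by apply: (addrI (d 0)); rewrite -gauge_opD !addr0. Qed.
Lemma gauge_opZ x (d : gauge x) (a : R) u : d (a *: u) = a *: d u.
Proof. by rewrite -[a *: u]addr0 gauge_lin gauge_op0 addr0. Qed.
Lemma gauge_opB x (d : gauge x) u v : d (u - v) = d u - d v.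
Proof. by rewrite gauge_opD -[in LHS]scaleN1r gauge_opZ scaleN1r. Qed.

Definition gauge_smooth (U : set M) (d : fam gauge) :=
  (forall u, smooth_sec (b := E) U (fun x => (d x : gauge x) u)) /\
  smooth_sec (b := tangent_bundle) U (fun x => gauge_symbol (d x)).
Fact gauge_smooth0 U : gauge_smooth U 0.
Proof. by split=> [u|]; exact: smooth_sec0. Qed.
Fact gauge_smoothD U c d : gauge_smooth U c -> gauge_smooth U d ->
  gauge_smooth U (c + d).
Proof.
move=> [c1 c2] [d1 d2]; split=> [u|]; first exact: (smooth_secD (c1 u) (d1 u)).
exact: (smooth_secD c2 d2).
Qed.
Fact gauge_smoothZ U (h : M -> R^o) d : open U -> smooth_on U h ->
  gauge_smooth U d ->
  gauge_smooth U (fun x => h x *: d x).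
Proof.
move=> oU sh [d1 d2]; split=> [u|]; first exact: (smooth_secZ oU sh (d1 u)).
exact: (smooth_secZ oU sh d2).
Qed.
Fact gauge_smoothS U U' d : U' `<=` U -> gauge_smooth U d -> gauge_smooth U' d.
Proof.
move=> UU [d1 d2]; split=> [u|]; first exact: (smooth_secS UU (d1 u)).
exact: (smooth_secS UU d2).
Qed.
Fact gauge_smooth_local U d :
  (forall x, U x -> exists V c,
    [/\ open V, V x, gauge_smooth V c & forall y, V y -> d y = c y]) ->
  gauge_smooth U d.
Proof.
move=> H; split=> [u|]; apply: smooth_sec_local => x /H[V [c [oV Vx [c1 c2] cd]]].
- by exists V, (fun x => (c x : gauge x) u); split=> // y /cd ->.
- by exists V, (fun x => gauge_symbol (c x)); split=> // y /cd ->.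
Qed.
Definition gauge_bundle : bundle :=
  Bundle gauge_smooth0 gauge_smoothD gauge_smoothZ gauge_smoothS
         gauge_smooth_local.

Implicit Types d r : gamma gauge_bundle.

Definition dact d u : gamma E := to_gamma ((gamma_smooth d).1 u).
Definition dsymbol d : gamma tangent_bundle := to_gamma (gamma_smooth d).2.

Lemma dact_leibniz d f u :
  dact d (gscale f u) = gscale f (dact d u) + gscale (vact (dsymbol d) f) u.
Proof. by apply: gammaP => x; exact: gauge_leibniz. Qed.
Lemma dact_lin d (a : R) u v : dact d (a *: u + v) = a *: dact d u + dact d v.
Proof. by apply: gammaP => x; exact: gauge_lin. Qed.

Fact vbracket_subproof (X Y : gamma tangent_bundle) x :
  is_derivation x (fun f => (X x : tangent x) (vact Y f)
                          - (Y x : tangent x) (vact X f)).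
Proof.
have vactL (Z : gamma tangent_bundle) (a : R) f g :
    vact Z (a *: f + g) = a *: vact Z f + vact Z g.
  apply: val_inj; apply/funext => y; exact: tangent_lin.
have vactM (Z : gamma tangent_bundle) f g :
    vact Z (cmul f g) = cmul f (vact Z g) + cmul g (vact Z f).
  apply: val_inj; apply/funext => y; exact: tangent_leibniz.
have tD (v : tangent x) f g : v (f + g) = v f + v g.
  by rewrite -[f in LHS]scale1r tangent_lin mul1r.
split=> [a f g|f g].
  rewrite !vactL !tangent_lin mulrBr opprD addrACA //.
rewrite !vactM !tD !tangent_leibniz.
rewrite -[vact Y g x]/((Y x : tangent x) g) -[vact Y f x]/((Y x : tangent x) f).
rewrite -[vact X g x]/((X x : tangent x) g) -[vact X f x]/((X x : tangent x) f).
by ring.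
Qed.

Fact gbracket_arith (W : zmodType) (p q r s t w : W) :
  p + q + (r + s) - (t + r + (q + w)) = (p - t) + (s - w).
Proof.
have -> : p + q + (r + s) = p + s + (q + r) by rewrite [r + s]addrC addrACA.
have -> : t + r + (q + w) = t + w + (q + r).
  by rewrite [q + w]addrC addrACA [r + q]addrC.
by rewrite opprD addrACA subrr addr0 opprD addrACA.
Qed.

Definition gbracket_at d r (x : M) : (gamma E -> E x) * tangent x :=
  (fun u => (d x : gauge x) (dact r u) - (r x : gauge x) (dact d u),
   subelt (W := tangent_subspace x) (vbracket_subproof (dsymbol d) (dsymbol r) x)).

Fact gbracket_subproof d r x : gauge_subspace x (gbracket_at d r x).
Proof.
have gD (c : gauge x) u v : c (u + v) = c u + c v by exact: gauge_opD.
split=> [a u v|f u] /=.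
  by rewrite !dact_lin !gauge_lin scalerBr opprD addrACA.
rewrite !dact_leibniz !gauge_opD !gauge_leibniz.
rewrite -[dact r u x]/((r x : gauge x) u) -[dact d u x]/((d x : gauge x) u).
set A := (d x : gauge x) (dact r u); set B := (r x : gauge x) (dact d u).
set C := (d x : gauge x) u; set D := (r x : gauge x) u.
set a := gauge_symbol (d x) (vact (dsymbol r) f).
set b := gauge_symbol (r x) (vact (dsymbol d) f).
rewrite -[RHS]/(f x *: (A - B) + (a - b) *: u x).
rewrite -[vact (dsymbol r) f x]/(gauge_symbol (r x) f).
rewrite -[vact (dsymbol d) f x]/(gauge_symbol (d x) f).
by rewrite gbracket_arith scalerBr scalerBl.
Qed.

Fact gbracket_smooth d r : gauge_smooth setT
  (fun x => subelt (W := gauge_subspace x) (gbracket_subproof d r x)).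
Proof.
split=> [u|f].
- exact: gamma_smooth (dact d (dact r u) - dact r (dact d u)).
- exact: cinf_smooth (vact (dsymbol d) (vact (dsymbol r) f)
                     - vact (dsymbol r) (vact (dsymbol d) f)).
Qed.

(* commutator of differential operators, see gbracketE *)
Definition gbracket d r : gamma gauge_bundle := 
  to_gamma (V := gauge_bundle) (gbracket_smooth d r).

Lemma gbracketE d r u :
  dact (gbracket d r) u = dact d (dact r u) - dact r (dact d u).
Proof. exact: gammaP. Qed.

End gauge.

Section jets.
Variable E : bundle.
Implicit Types (u : gamma E) (f g : cinf M).

(* The fibre of JE at x is Gamma(E) / m_x^2 Gamma(E), with m_x the ideal of the
   smooth functions vanishing at x: two sections have the same first jet at x
   iff their difference vanishes at x to second order. *)
Definition flat_sections (x : M) : subspace (gamma E) :=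
  lspan_subspace [set u | exists f g w,
    [/\ f x = 0, g x = 0 & u = gscale (cmul f g) w]].

Definition jet (x : M) : Type := quot_space (flat_sections x).
HB.instance Definition _ x := GRing.Lmodule.on (jet x).
Definition jet_of (x : M) (u : gamma E) : jet x := qproj (flat_sections x) u.
Definition jet_repr (x : M) (m : jet x) : gamma E := qrepr m.

Lemma jet_reprK x (m : jet x) : jet_of x (jet_repr m) = m.
Proof. exact: qreprK. Qed.
Lemma jet_ofD x u v : jet_of x (u + v) = jet_of x u + jet_of x v.
Proof. exact: qprojD. Qed.
Lemma jet_ofZ x (a : R) u : jet_of x (a *: u) = a *: jet_of x u.
Proof. exact: qprojZ. Qed.

(* a section of JE is smooth iff it is locally a combination of first jets of
   sections of E with smooth coefficients *)
Definition jet_smooth (U : set M) (m : fam jet) :=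
  forall x, U x -> exists V (s : seq ((M -> R^o) * gamma E)),
    [/\ open V, V x, forall p, p \in s -> smooth_on V p.1 &
        forall y, V y -> m y = \sum_(p <- s) p.1 y *: jet_of y p.2].

Fact jet_smooth0 U : jet_smooth U 0.
Proof.
move=> x _; exists setT, [::]; split=> //; first exact: openT.
by move=> y _; rewrite big_nil.
Qed.
Fact jet_smoothD U m m' : jet_smooth U m -> jet_smooth U m' ->
  jet_smooth U (m + m').
Proof.
move=> sm sm' x Ux; have [V [s [oV Vx ss ms]]] := sm x Ux.
have [V' [s' [oV' Vx' ss' ms']]] := sm' x Ux.
exists (V `&` V'), (s ++ s'); split=> //; first exact: openI.
- move=> p; rewrite mem_cat => /orP[/ss|/ss']; apply: smooth_onS.
  + by move=> y [].
  + by move=> y [].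
- by move=> y [Vy Vy']; rewrite big_cat /= -ms // -ms'.
Qed.
Fact jet_smoothZ U (h : M -> R^o) m : open U -> smooth_on U h ->
  jet_smooth U m -> jet_smooth U (fun x => h x *: m x).
Proof.
move=> oU sh sm x Ux; have [V [s [oV Vx ss ms]]] := sm x Ux.
exists (V `&` U), [seq (fun y => h y * p.1 y, p.2) | p <- s].
split=> //; first exact: openI.
- move=> _ /mapP[p ps ->] /=; apply: smooth_onM.
  + by apply: smooth_onS sh => y [].
  + by apply: smooth_onS (ss p ps) => y [].
- move=> y [Vy _]; rewrite ms // scaler_sumr big_map /=.
  by apply: eq_bigr => p _; rewrite scalerA.
Qed.
Fact jet_smoothS U U' m : U' `<=` U -> jet_smooth U m -> jet_smooth U' m.
Proof. by move=> UU sm x /UU /sm. Qed.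
Fact jet_smooth_local U m :
  (forall x, U x -> exists V m',
    [/\ open V, V x, jet_smooth V m' & forall y, V y -> m y = m' y]) ->
  jet_smooth U m.
Proof.
move=> H x /H[V [m' [oV Vx /(_ x Vx)[V' [s [oV' Vx' ss ms]]] mm']]].
exists (V `&` V'), s; split=> //; first exact: openI.
- by move=> p /ss; apply: smooth_onS => y [].
- by move=> y [Vy Vy']; rewrite mm' // ms.
Qed.
Definition jet_bundle : bundle :=
  Bundle jet_smooth0 jet_smoothD jet_smoothZ jet_smoothS jet_smooth_local.

Fact jet_sec_subproof u : jet_smooth setT (fun x => jet_of x u).
Proof.
move=> x _; exists setT, [:: (fun=> 1, u)]; split=> //; first exact: openT.
- by move=> p; rewrite inE => /eqP ->; exact: smooth_on_cst.
- by move=> y _; rewrite big_seq1 scale1r.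
Qed.
Definition jet_sec u : gamma jet_bundle :=
  to_gamma (V := jet_bundle) (jet_sec_subproof u).

(* Both maps below are computed on a representative; they do not depend on it,
   see jet_projE and jet_pairingE. *)
Definition jet_proj (x : M) (m : jet x) : E x := jet_repr m x.
Definition jet_pairing (x : M) (m : jet x) (d : gauge E x) : E x :=
  d (jet_repr m).

Lemma jet_pairingE x u (d : gauge E x) : jet_pairing (jet_of x u) d = d u.
Proof.
have kerD (a b : gamma E) : d a = 0 -> d b = 0 -> d (a + b) = 0.
  by rewrite gauge_opD => -> ->; rewrite addr0.
have kerZ (a : R) (b : gamma E) : d b = 0 -> d (a *: b) = 0.
  by rewrite gauge_opZ => ->; rewrite scaler0.
have : flat_sections x (jet_repr (jet_of x u) - u).
  by apply/qproj_eq; exact: jet_reprK.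
move/(_ (@Subspace _ _ (fun a => d a = 0) (gauge_op0 d) kerD kerZ)) => /= H.
apply/eqP; rewrite -subr_eq0 -gauge_opB; apply/eqP; apply: H.
move=> _ [f [g [w [fx0 gx0 ->]]]] /=; rewrite gauge_leibniz.
rewrite -[cmul f g x]/(f x * g x) fx0 mul0r scale0r add0r.
by rewrite tangent_leibniz fx0 gx0 !mul0r addr0 scale0r.
Qed.

Lemma jet_projE x u : jet_proj (jet_of x u) = u x.
Proof.
have evD (a b : gamma E) : a x = 0 -> b x = 0 -> (a + b : gamma E) x = 0.
  by move=> a0 b0; rewrite -[LHS]/(a x + b x) a0 b0 addr0.
have evZ (a : R) (b : gamma E) : b x = 0 -> (a *: b : gamma E) x = 0.
  by move=> b0; rewrite -[LHS]/(a *: b x) b0 scaler0.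
have : flat_sections x (jet_repr (jet_of x u) - u).
  by apply/qproj_eq; exact: jet_reprK.
move/(_ (@Subspace _ _ (fun a : gamma E => a x = 0) (erefl _) evD evZ)) => /= H.
apply/eqP; rewrite -subr_eq0; apply/eqP; apply: H.
move=> _ [f [g [w [fx0 gx0 ->]]]] /=.
by rewrite -[LHS]/((f x * g x) *: w x) fx0 mul0r scale0r.
Qed.

Lemma jet_pairingD x (m m' : jet x) d :
  jet_pairing (m + m') d = jet_pairing m d + jet_pairing m' d.
Proof.
by rewrite -(jet_reprK m) -(jet_reprK m') -jet_ofD !jet_pairingE gauge_opD.
Qed.
Lemma jet_pairingZ x (a : R) (m : jet x) d :
  jet_pairing (a *: m) d = a *: jet_pairing m d.
Proof. by rewrite -(jet_reprK m) -jet_ofZ !jet_pairingE gauge_opZ. Qed.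
Lemma jet_projD x (m m' : jet x) :
  jet_proj (m + m') = jet_proj m + jet_proj m'.
Proof. by rewrite -(jet_reprK m) -(jet_reprK m') -jet_ofD !jet_projE. Qed.
Lemma jet_projZ x (a : R) (m : jet x) : jet_proj (a *: m) = a *: jet_proj m.
Proof. by rewrite -(jet_reprK m) -jet_ofZ !jet_projE. Qed.

Lemma jet_map_smooth (phi : forall x, jet x -> E x) :
  (forall x (m m' : jet x), phi x (m + m') = phi x m + phi x m') ->
  (forall x (a : R) (m : jet x), phi x (a *: m) = a *: phi x m) ->
  (forall u, smooth_sec (b := E) setT (fun x => phi x (jet_of x u))) ->
  forall m : gamma jet_bundle, smooth_sec (b := E) setT (fun x => phi x (m x)).
Proof.
move=> phiD phiZ phiJ m; apply: (smooth_sec_local (b := E)) => x _.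
have [V [s [oV Vx ss ms]]] := gamma_smooth m x I.
have phi0 y : phi y 0 = 0 by rewrite -(scale0r 0) phiZ scale0r.
exists V, (fun y => \sum_(p <- s) p.1 y *: phi y (jet_of y p.2)).
split=> // [|y Vy]; last first.
  rewrite ms //.
  elim: s {ss ms} => [|p s IH]; first by rewrite !big_nil phi0.
  by rewrite !big_cons phiD phiZ IH.
pose F s : fam E := fun y => \sum_(p <- s) p.1 y *: phi y (jet_of y p.2).
rewrite -[X in smooth_sec _ X]/(F s).
elim: s ss {ms} => [|p s IH] ss.
  have -> : F [::] = 0.
    by apply: functional_extensionality_dep => y; rewrite /F big_nil.
  exact: smooth_sec0.
have -> : F (p :: s) = ((fun y => p.1 y *: phi y (jet_of y p.2)) : fam E) + F s.
  by apply: functional_extensionality_dep => y; rewrite /F big_cons.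
apply: smooth_secD; last by apply: IH => q qs; apply: ss; rewrite inE qs orbT.
apply: smooth_secZ => //; first by apply: ss; rewrite inE eqxx.
exact: smooth_secS (phiJ _).
Qed.

Fact jpairing_subproof (m : gamma jet_bundle) (d : gamma (gauge_bundle E)) :
  smooth_sec (b := E) setT (fun x => jet_pairing (m x) (d x)).
Proof.
apply: (jet_map_smooth (phi := fun x m => jet_pairing m (d x))) => [x|x|u].
- by move=> m1 m2; exact: jet_pairingD.
- by move=> a m1; exact: jet_pairingZ.
- rewrite (_ : (fun x => _) = gamma_fun (dact d u)); first exact: gamma_smooth.
  by apply: functional_extensionality_dep => x; exact: jet_pairingE.
Qed.
Definition jpairing (m : gamma jet_bundle) (d : gamma (gauge_bundle E)) :
  gamma E := to_gamma (jpairing_subproof m d).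

Fact jproj_subproof (m : gamma jet_bundle) :
  smooth_sec (b := E) setT (fun x => jet_proj (m x)).
Proof.
apply: (jet_map_smooth (phi := fun x m => jet_proj m)) => [x|x|u].
- by move=> m1 m2; exact: jet_projD.
- by move=> a m1; exact: jet_projZ.
- rewrite (_ : (fun x => _) = gamma_fun u); first exact: gamma_smooth.
  by apply: functional_extensionality_dep => x; exact: jet_projE.
Qed.
Definition jproj (m : gamma jet_bundle) : gamma E :=
  to_gamma (jproj_subproof m).

(* The section of JE characterized by its pairings with all sections of DE (it
   exists, and it is unique because the pairing is nondegenerate). *)
Definition lie_derivative (d : gamma (gauge_bundle E))
    (m : gamma jet_bundle) : gamma jet_bundle :=
  xget 0 [set m' | forall r, jpairing m' r =
                             dact d (jpairing m r) - jpairing m (gbracket d r)].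

End jets.

(* Vector bundles of constant rank k, by local trivializations vcoord whose
   transition maps x |-> g x are smooth.  vcoord i x is only meaningful for x in
   vdom i. *)
Record vector_bundle (k : nat) := VectorBundle {
  vfib : M -> lmodType R;
  vtriv : Type;
  vdom : vtriv -> set M;
  vcoord : vtriv -> forall x, {linear vfib x -> 'rV[R]_k};
  vdom_open : forall i, open (vdom i);
  vdom_cover : forall x, exists i, vdom i x;
  vcoord_bij : forall i x, vdom i x -> bijective (vcoord i x);
  vcoord_smooth : forall i j, exists g : M -> 'M[R]_k,
    (forall a b, smooth_on (vdom i `&` vdom j) (fun x => g x a b)) /\
    (forall x, vdom i x -> vdom j x ->
       forall e, vcoord j x e = vcoord i x e *m g x) }.

Section vector_bundle_sections.
Variables (k : nat) (E : vector_bundle k).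
Definition vsmooth (U : set M) (s : fam (vfib E)) :=
  forall (i : vtriv E) (b : 'I_k),
    smooth_on (U `&` vdom i) (fun x => vcoord i x (s x) 0 b).
Fact vsmooth0 U : vsmooth U 0.
Proof.
move=> i b; rewrite (_ : (fun x => _) = (fun=> 0)); first exact: smooth_on_cst.
by apply/funext => x; rewrite -[(0 : fam _) x]/(0 : vfib E x) linear0 mxE.
Qed.
Fact vsmoothD U s t : vsmooth U s -> vsmooth U t -> vsmooth U (s + t).
Proof.
move=> ss st i b; rewrite (_ : (fun x => _) = (fun x =>
  (vcoord i x (s x) 0 b : R^o) + vcoord i x (t x) 0 b)).
  exact: smooth_onD.
by apply/funext => x; rewrite -[(s + t) x]/(s x + t x) linearD mxE.
Qed.
Fact vsmoothZ U (f : M -> R^o) s : open U -> smooth_on U f -> vsmooth U s ->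
  vsmooth U (fun x => f x *: s x).
Proof.
move=> _ sf ss i b; rewrite (_ : (fun x => _) = (fun x =>
  f x * (vcoord i x (s x) 0 b : R^o))).
  by apply: smooth_onM => //; apply: smooth_onS sf => x [].
by apply/funext => x; rewrite linearZ mxE.
Qed.
Fact vsmoothS U U' s : U' `<=` U -> vsmooth U s -> vsmooth U' s.
Proof. by move=> UU ss i b; apply: smooth_onS (ss i b) => x [/UU]. Qed.
Fact vsmooth_local U s :
  (forall x, U x -> exists V t,
    [/\ open V, V x, vsmooth V t & forall y, V y -> s y = t y]) ->
  vsmooth U s.
Proof.
move=> H i b; apply: smooth_on_local => x [/H[V [t [oV Vx st stE]]] ix].
exists (V `&` vdom i), (fun x => vcoord i x (t x) 0 b); split=> //.
- by apply: openI => //; exact: vdom_open.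
- by move=> y [/stE ->].
Qed.
Definition vector_bundle_bundle : bundle :=
  Bundle vsmooth0 vsmoothD vsmoothZ vsmoothS vsmooth_local.
End vector_bundle_sections.
Coercion vector_bundle_bundle : vector_bundle >-> bundle.

Section omni.
Variable E : bundle.

Definition omni : bundle := bsum (gauge_bundle E) (jet_bundle E).
Definition calT : bundle := bsum tangent_bundle E.

Definition omni_bracket (X Y : gamma omni) : gamma omni :=
  let d := gfst X in let m := gsnd X in let r := gfst Y in let p := gsnd Y in
  gpair (gbracket d r)
    (lie_derivative d p - lie_derivative r m + jet_sec (jpairing m r)).

Definition omni_pairing_at (x : M) (X Y : omni x) : E x :=
  2^-1 *: (jet_pairing Y.2 X.1 + jet_pairing X.2 Y.1).

Definition omni_pairing (X Y : gamma omni) : gamma E :=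
  2^-1 *: (jpairing (gsnd Y) (gfst X) + jpairing (gsnd X) (gfst Y)).

Lemma omni_pairingE X Y x : omni_pairing X Y x = omni_pairing_at (X x) (Y x).
Proof. by []. Qed.

Definition bmap_at (x : M) (X : omni x) : calT x :=
  (gauge_symbol X.1, jet_proj X.2).

Definition bmap (X : gamma omni) : gamma calT :=
  gpair (dsymbol (gfst X)) (jproj (gsnd X)).

Lemma bmapE X x : bmap X x = bmap_at (X x).
Proof. by []. Qed.

Definition orthogonal (x : M) (S : set (omni x)) : set (omni x) :=
  [set X | forall s, S s -> omni_pairing_at X s = 0].

(* maximal isotropic is expressed as L^perp = L, fibrewise *)
Record dirac := Dirac {
  dirac_rank : nat;
  dirac_subbundle :> subbundle omni dirac_rank;
  dirac_lagrangian : forall x,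
    orthogonal (dirac_subbundle x) = (dirac_subbundle x : set (omni x));
  dirac_integrable : forall X Y : gamma omni,
    sgamma_subspace dirac_subbundle X -> sgamma_subspace dirac_subbundle Y ->
    sgamma_subspace dirac_subbundle (omni_bracket X Y) }.

(* b(L) has constant rank *)
Definition reducible (L : dirac) :=
  exists r : nat, forall x, exists e : 'I_r -> calT x,
    is_basis e [set bmap_at X | X in (L x : set (omni x))].

Section dirac_cohomology.
Variable L : dirac.

Definition dbracket (X Y : sgamma L) : sgamma L :=
  to_sgamma (dirac_integrable (sgamma_in X) (sgamma_in Y)).

Definition drep (X : sgamma L) (e : gamma E) : gamma E := dact (gfst X) e.

(* Gamma(Hom(L, E)) as the C^oo(M)-linear maps Gamma(L) -> Gamma(E); additivity
   and compatibility with smooth functions give R-linearity. *)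
Definition is_cochain1 (w : sgamma L -> gamma E) :=
  (forall X Y, w (X + Y) = w X + w Y) /\
  (forall f X, w (sgscale f X) = gscale f (w X)).

Definition d0 (e : gamma E) : sgamma L -> gamma E := fun X => drep X e.
Definition d1 (w : sgamma L -> gamma E) (X Y : sgamma L) : gamma E :=
  drep X (w Y) - drep Y (w X) - w (dbracket X Y).

Definition is_cocycle1 (w : sgamma L -> gamma E) :=
  is_cochain1 w /\ forall X Y, d1 w X Y = 0.

Let drepD X u v : drep X (u + v) = drep X u + drep X v.
Proof. by rewrite -[u in LHS]scale1r /drep dact_lin scale1r. Qed.
Let drep0 X : drep X 0 = 0.
Proof. by apply: (addrI (drep X 0)); rewrite -drepD !addr0. Qed.
Let drepZ X (a : R) u : drep X (a *: u) = a *: drep X u.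
Proof. by rewrite -[a *: u]addr0 /drep dact_lin -/(drep X 0) drep0 addr0. Qed.

Fact cocycle0 : is_cocycle1 0.
Proof.
split; first split=> [X Y|f X].
- by rewrite /= addr0.
- by apply: gammaP => x; rewrite -[RHS]/(f x *: 0) scaler0.
- by move=> X Y; rewrite /d1 /= !drep0 !subr0.
Qed.
Fact cocycleD v w : is_cocycle1 v -> is_cocycle1 w -> is_cocycle1 (v + w).
Proof.
have ev X : (v + w) X = v X + w X by [].
move=> [[vD vZ] dv] [[wD wZ] dw]; split; first split=> [X Y|f X].
- by rewrite !ev vD wD addrACA.
- rewrite !ev vZ wZ; apply: gammaP => x.
  by rewrite -[RHS]/(f x *: (v X x + w X x)) scalerDr.
- move=> X Y; transitivity (d1 v X Y + d1 w X Y); last by rewrite dv dw addr0.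
  by rewrite /d1 !ev !drepD !opprD [X in X + _ = _]addrACA [LHS]addrACA.
Qed.
Fact cocycleZ (a : R) w : is_cocycle1 w -> is_cocycle1 (a *: w).
Proof.
have ev X : (a *: w) X = a *: w X by [].
move=> [[wD wZ] dw]; split; first split=> [X Y|f X].
- by rewrite !ev wD scalerDr.
- rewrite !ev wZ; apply: gammaP => x.
  rewrite -[LHS]/(a *: (f x *: w X x)) -[RHS]/(f x *: (a *: w X x)).
  by rewrite !scalerA mulrC.
- by move=> X Y; rewrite /d1 !ev !drepZ -!scalerBr -/(d1 w X Y) dw scaler0.
Qed.
Definition Z1_subspace : subspace (sgamma L -> gamma E) :=
  Subspace cocycle0 cocycleD cocycleZ.
Definition Z1 : Type := subspace_type Z1_subspace.
HB.instance Definition _ := GRing.Lmodule.on Z1.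
Definition Z1_fun (w : Z1) : sgamma L -> gamma E := sval_of w.
Coercion Z1_fun : Z1 >-> Funclass.

Definition is_coboundary1 (w : Z1) := exists e, w = d0 e :> (_ -> _).
Fact coboundary0 : is_coboundary1 0.
Proof. by exists 0; apply/funext => X; rewrite /d0 drep0. Qed.
Fact coboundaryD v w : is_coboundary1 v -> is_coboundary1 w ->
  is_coboundary1 (v + w).
Proof.
move=> [e ve] [e' we]; exists (e + e'); apply/funext => X.
by rewrite /d0 drepD -/(d0 e X) -/(d0 e' X) -ve -we.
Qed.
Fact coboundaryZ (a : R) w : is_coboundary1 w -> is_coboundary1 (a *: w).
Proof.
move=> [e we]; exists (a *: e); apply/funext => X.
by rewrite /d0 drepZ -/(d0 e X) -we.
Qed.
Definition B1_subspace : subspace Z1 :=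
  Subspace coboundary0 coboundaryD coboundaryZ.

Definition H1 : Type := quot_space B1_subspace.
HB.instance Definition _ := GRing.Lmodule.on H1.
Definition H1_class (w : Z1) : H1 := qproj B1_subspace w.
End dirac_cohomology.

(* the anchor is the projection to TM, i.e. gfst *)
Record projective_algebroid (r : nat) := ProjectiveAlgebroid {
  pa_subbundle :> subbundle calT r;
  pa_bracket : sgamma pa_subbundle -> sgamma pa_subbundle ->
               sgamma pa_subbundle;
  pa_bracket_linear : forall a (t : R) b c,
    pa_bracket a (t *: b + c) = t *: pa_bracket a b + pa_bracket a c;
  pa_bracket_skew : forall a b, pa_bracket a b = - pa_bracket b a;
  pa_bracket_jacobi : forall a b c,
    pa_bracket a (pa_bracket b c) =
    pa_bracket (pa_bracket a b) c + pa_bracket b (pa_bracket a c);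
  pa_bracket_leibniz : forall a f b,
    pa_bracket a (sgscale f b) =
    sgscale f (pa_bracket a b) + sgscale (vact (gfst a) f) b }.

Section ext.
Variables (r : nat) (A : projective_algebroid r).

Definition is_der (D : sgamma A -> sgamma A) :=
  [/\ forall (t : R) a b, D (t *: a + b) = t *: D a + D b,
      exists X : gamma tangent_bundle, forall f a,
        D (sgscale f a) = sgscale f (D a) + sgscale (vact X f) a &
      forall a b, D (pa_bracket a b) = pa_bracket (D a) b + pa_bracket a (D b)].

Let sgammaP (s t : sgamma A) : (forall x, s x = t x) -> s = t.
Proof. by move=> st; apply: val_inj; exact: gammaP. Qed.
Let brD a b c : pa_bracket (a : sgamma A) (b + c) = pa_bracket a b + pa_bracket a c.
Proof. by rewrite -[b in LHS]scale1r pa_bracket_linear scale1r. Qed.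
Let br0 a : pa_bracket (a : sgamma A) 0 = 0.
Proof. by apply: (addrI (pa_bracket a 0)); rewrite -brD !addr0. Qed.
Let brZ a (t : R) b : pa_bracket (a : sgamma A) (t *: b) = t *: pa_bracket a b.
Proof. by rewrite -[t *: b]addr0 pa_bracket_linear br0 addr0. Qed.
Let brDl a b c : pa_bracket (a + b) (c : sgamma A) = pa_bracket a c + pa_bracket b c.
Proof. by rewrite pa_bracket_skew brD opprD -!pa_bracket_skew. Qed.
Let brZl (t : R) a c : pa_bracket (t *: a) (c : sgamma A) = t *: pa_bracket a c.
Proof. by rewrite pa_bracket_skew brZ -scalerN -pa_bracket_skew. Qed.
Let br0l a : pa_bracket 0 (a : sgamma A) = 0.
Proof. by rewrite pa_bracket_skew br0 oppr0. Qed.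

Fact der0 : is_der 0.
Proof.
split=> [t a b||a b]; first by rewrite /= scaler0 addr0.
- exists 0 => f a; apply: sgammaP => x.
  rewrite -[RHS]/(f x *: 0 + 0 *: a x).
  by rewrite scaler0 scale0r addr0.
- by rewrite /= br0 br0l addr0.
Qed.
Fact derD C D : is_der C -> is_der D -> is_der (C + D).
Proof.
have ev a : (C + D) a = C a + D a by [].
move=> [C1 [X CX] C3] [D1 [Y DY] D3]; split=> [t a b||a b].
- by rewrite !ev C1 D1 scalerDr addrACA.
- exists (X + Y) => f a; rewrite !ev CX DY; apply: sgammaP => x.
  rewrite -[RHS]/(f x *: (C a x + D a x) + (vact X f x + vact Y f x) *: a x).
  by rewrite scalerDr scalerDl addrACA.
- by rewrite !ev C3 D3 brD brDl addrACA.
Qed.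
Fact derZ (t : R) D : is_der D -> is_der (t *: D).
Proof.
have ev a : (t *: D) a = t *: D a by [].
move=> [D1 [Y DY] D3]; split=> [s a b||a b].
- by rewrite !ev D1 scalerDr !scalerA mulrC.
- exists (t *: Y) => f a; rewrite !ev DY; apply: sgammaP => x.
  rewrite -[LHS]/(t *: (f x *: D a x + vact Y f x *: a x)).
  rewrite -[RHS]/(f x *: (t *: D a x) + (t * vact Y f x) *: a x).
  by rewrite scalerDr !scalerA mulrC.
- by rewrite !ev D3 brZ brZl scalerDr.
Qed.
Definition Der_subspace : subspace (sgamma A -> sgamma A) :=
  Subspace der0 derD derZ.
Definition Der : Type := subspace_type Der_subspace.
HB.instance Definition _ := GRing.Lmodule.on Der.
Definition Der_fun (D : Der) : sgamma A -> sgamma A := sval_of D.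
Coercion Der_fun : Der >-> Funclass.

Definition is_inn (D : Der) :=
  exists a : sgamma A, forall b, D b = pa_bracket a b.
Fact inn0 : is_inn 0.
Proof. by exists 0 => b; rewrite br0l. Qed.
Fact innD C D : is_inn C -> is_inn D -> is_inn (C + D).
Proof. by move=> [a Ca] [b Db]; exists (a + b) => c; rewrite brDl -Ca -Db. Qed.
Fact innZ (t : R) D : is_inn D -> is_inn (t *: D).
Proof. by move=> [a Da]; exists (t *: a) => c; rewrite brZl -Da. Qed.
Definition Inn_subspace : subspace Der := Subspace inn0 innD innZ.

Definition Ext : Type := quot_space Inn_subspace.
HB.instance Definition _ := GRing.Lmodule.on Ext.
Definition Ext_class (D : Der) : Ext := qproj Inn_subspace D.

(* the properties characterizing the lifted Dirac structure L^A *)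
Definition is_lifted_dirac (L : dirac) :=
  [/\ reducible L,
      forall x, [set bmap_at X | X in (L x : set (omni x))] = (A x : set (calT x)) &
      forall (X Y : sgamma L) (a b : sgamma A), bmap X = a -> bmap Y = b ->
        bmap (omni_bracket X Y) = pa_bracket a b].
End ext.

Definition normalizer r (C : subbundle omni r) : set (gamma omni) :=
  [set X | forall Y, sgamma_subspace C Y ->
           sgamma_subspace C (omni_bracket X Y)].

(* xget selects some Y with b(Y) = t; such Y exist and the value does not depend
   on the one selected. *)
Definition falling (X : gamma omni) (t : gamma calT) : gamma calT :=
  bmap (omni_bracket X (xget 0 [set Y | bmap Y = t])).

Definition omega (L : dirac) (X : gamma omni) : sgamma L -> gamma E :=
  fun Y => omni_pairing X Y.

End omni.

End bundles.
End manifolds.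

Arguments manifold R n : clear implicits.
Arguments bundle {R n} M.
Arguments vector_bundle {R n} M k.

(* Main.v *)
From HB Require Import structures.
From mathcomp Require Import all_boot all_order all_algebra.
From mathcomp Require Import boolp classical_sets functions cardinality reals.
From mathcomp Require Import topology normedtype derive sequences realfun exp.
From mathcomp Require Import ring lra.
Require Import Defs.
Import Order.TTheory GRing.Theory Num.Theory.
Import numFieldNormedType.Exports.
Set Implicit Arguments.
Unset Strict Implicit.
Unset Printing Implicit Defensive.
Local Open Scope classical_set_scope.
Local Open Scope ring_scope.

(** For X, Y in Γ(ℰ) one has the identity
      d_L ω_X (Y, Z) = - ({X, Y}, Z)_E,
    so by maximal isotropy X normalizes L iff ω_X is a cocycle, and ω_X = d_L e
    iff X - 2 de is in Γ(L).  The bracket b{X, Y} depends on Y through bY only,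
    b{de, Y} = 0, and b{l, Y} = [bl, bY]_A for l, Y in Γ(L); hence ω_X is exact
    iff X_• acts on Γ(A) as an inner derivation (for the converse, if X_•
    vanishes on A then X has no symbol and ω_X = d_L e with 2e = p(X)).
    A derivation δ of A with symbol v acts on TM-components as [v, -], and its
    E-component is a connection along v plus a tensorial term, so it is X_• for
    some X glued with a partition of unity; the identity
      p{X, {Y, Z}} + p{Z, {X, Y}} - p{Y, {X, Z}} = 2 ({X, Y}, Z)_E
    then turns the derivation rule for δ into X being in the normalizer of L.

    Tangent vectors are never expanded in coordinate fields: sections of jets
    and membership in L are only tested through the pairing with global
    sections, so no form of Hadamard's lemma is needed. *)

(** * Calculus on R^n *)

(** Only [E] and the subbundles come with frames; [DE], [JE] and their sum are known through fibres
    and smooth sections. Existence statements are therefore homogenized: a fibrewise linear problem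
    is replaced by the pairs (c, s) in which s solves c times the problem. These pairs form a
    subspace of each fibre, so they may be multiplied by smooth functions, a determinant or a
    cut-off is absorbed into c instead of being inverted, and it suffices to find, for each point,
    one global pair with c nonzero there. The Lie derivative, the lifts to [L] of sections of [A],
    and the X realizing a derivation all arise in this way. For the last of these, the tensorial
    part of the derivation is only given on [A] and has to come from an element of the kernel of b.
    Hence coordinates on [A] are built solely from functionals l on TM + E for which every l tensor
    w is induced by such an element: the differentials dg and the fibre coordinates of [E]. *)

Section Ck_composition.
Context {R : realType} {n : nat}.
Implicit Types (f q : 'rV[R]_n -> R^o) (x y : 'rV[R]_n).

(** One order of the chain rule. A family of functions of one variable that is closed under
    derivation, up to sums and products, thus preserves C^k by induction on k. *)
Lemma Ck_comp_step k (h h' : R^o -> R^o) q x :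
  (\forall y \near x, is_derive (q y) 1 h (h' (q y))) ->
  Ck_at k (fun y => h' (q y)) x -> Ck_at k.+1 q x ->
  Ck_at k.+1 (fun y => h (q y)) x.
Proof.
move=> hd ch' [dq Dq]; split.
  apply: (@filterS2 _ (nbhs x) _ _ _ _ _ hd dq) => y hy dqy.
  apply: (@differentiable_comp _ _ _ _ q h) => //.
  exact: (derivable1_diffP _ _).1 (@ex_derive _ _ _ _ _ _ _ hy).
move=> i; apply: (@Ck_ext _ _ _ (fun y => h' (q y) * 'D_(delta_mx 0 i) q y));
  last by apply: CkM; [exact: ch'|exact: Dq].
apply: (@filterS2 _ (nbhs x) _ _ _ _ _ hd dq) => y hy dqy.
have dh : differentiable h (q y) by exact: (derivable1_diffP _ _).1 (@ex_derive _ _ _ _ _ _ _ hy).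
have dhq : differentiable (h \o q) y by exact: differentiable_comp.
rewrite -[RHS]/('D_(delta_mx 0 i) (h \o q) y) (deriveE _ dhq) diff_comp //=.
rewrite -(deriveE _ dqy) -(deriveE ('D_(delta_mx 0 i) q y) dh).
rewrite -[X in 'D_X h _](mulr1 ('D_(delta_mx 0 i) q y : R)).
rewrite (_ : ('D_(delta_mx 0 i) q y : R) * 1 = 'D_(delta_mx 0 i) q y *: (1 : R^o)) //.
by rewrite (deriveE _ dh) linearZ -(deriveE _ dh) (@derive_val _ _ _ _ _ _ _ hy) /= mulrC.
Qed.

Lemma CkV k q x : Ck_at k q x -> q x != 0 -> Ck_at k (fun y => (q y)^-1 : R^o) x.
Proof.
elim: k q => [|k IH] q cq qx; first exact: (cvgV qx cq).
have q0 : \forall y \near x, q y != 0.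
  have cx : {for x, continuous q} by exact: differentiable_continuous (nbhs_singleton cq.1).
  exact: (cvgr_neq0 _ cx).
have cV := IH _ (Ck_S cq) qx.
apply: (@Ck_comp_step _ (fun t : R^o => t^-1 : R^o) (fun t : R^o => - (t^-1 * t^-1) : R^o)) => //.
  apply: (@filterS _ (nbhs x) _ _ _ _ q0) => y qy.
  apply: is_derive_eq (@is_deriveV R id (q y) 1 1 qy (is_derive_id _ _)) _.
  by rewrite /GRing.scale /= mulr1 expr2 invfM.
have -> : (fun y => - ((q y)^-1 * (q y)^-1)) =
  (fun y => (-1 : R^o) * ((q y)^-1 * (q y)^-1) : R^o) by apply/funext => y; rewrite mulN1r.
by apply: CkM; [exact: Ck_cst|exact: CkM].
Qed.

End Ck_composition.

Section flat_function.
Context {R : realType}.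
Implicit Types (t : R) (m : nat).

(** The exponent [m] is a parameter because exp(-1/t) alone is not stable under derivation, whereas
    the derivative of [flat m] is a combination of [flat m.+2] and [flat m.+1]. *)
Definition flat m t : R := if 0 < t then t^-1 ^+ m * expR (- t^-1) else 0.

Lemma flat_ge0 m t : 0 <= flat m t.
Proof.
by rewrite /flat; case: ifP => // t0; rewrite mulr_ge0 ?expR_ge0// exprn_ge0// invr_ge0 ltW.
Qed.

Lemma flat_gt0 m t : 0 < t -> 0 < flat m t.
Proof. by move=> t0; rewrite /flat t0 mulr_gt0 ?expR_gt0// exprn_gt0// invr_gt0. Qed.

Lemma flat_le0 m t : t <= 0 -> flat m t = 0.
Proof. by move=> t0; rewrite /flat ltNge t0. Qed.

(** The term of degree m + 2 of the exponential series at 1/t bounds exp(1/t) from below. The square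
    of t, rather than a first power, makes the difference quotient at 0 tend to 0. *)
Lemma flat_bound m t : `|flat m t| <= (m.+2)`!%:R * `|t| ^+ 2.
Proof.
have [t0|t0] := ltP 0 t; last by rewrite flat_le0// normr0 mulr_ge0// exprn_ge0.
rewrite /flat t0 normrM ger0_norm ?exprn_ge0 ?invr_ge0 ?(ltW t0)//.
rewrite ger0_norm ?expR_ge0// gtr0_norm//.
have ti : 0 <= t^-1 by rewrite invr_ge0 ltW.
have h := expR_ge1Dxn m.+1 ti.
rewrite expRN ler_pdivrMr ?expR_gt0//.
have h2 : t^-1 ^+ m.+2 / (m.+2)`!%:R <= expR t^-1.
  by apply: le_trans h; rewrite lerDr.
rewrite ler_pdivrMr in h2; last by rewrite ltr0n fact_gt0.
rewrite -mulrA mulrCA.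
have -> : t^-1 ^+ m = t ^+ 2 * t^-1 ^+ m.+2.
  by rewrite -[m.+2]addn2 (exprD _ m 2) mulrCA -exprMn divff ?gt_eqF// expr1n mulr1.
rewrite ler_pM2l ?exprn_gt0//.
by rewrite mulrC.
Qed.

Lemma is_derive_flat m (t : R^o) :
  is_derive t 1 (flat m : R^o -> R^o) (flat m.+2 t - m%:R * flat m.+1 t).
Proof.
have [t0|t0|<-] := ltgtP 0 t.
- have tn : t != 0 by rewrite gt_eqF.
  apply: (@near_eq_is_derive _ _ _ ((fun s : R^o => s^-1 ^+ m * expR (- s^-1)) : R^o -> R^o)).
    by near=> s; rewrite /flat ifT//; near: s; exact: lt_nbhsr.
  have dV : is_derive t 1 (fun s : R^o => s^-1 : R^o) (- t^-2 : R^o).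
    apply: is_derive_eq (@is_deriveV R id t 1 1 tn (is_derive_id _ _)) _.
    by rewrite /GRing.scale /= mulr1.
  have dX := is_deriveX m dV.
  have dE : is_derive t 1 (fun s : R^o => expR (- s^-1) : R^o) (expR (- t^-1) * t^-2 : R^o).
    apply: is_derive_eq (@is_derive1_comp R expR (fun s => - s^-1) t _ _
      (is_derive_expR _) (is_deriveN dV)) _.
    by rewrite opprK.
  have -> : (fun s : R^o => s^-1 ^+ m * expR (- s^-1)) =
      ((fun s : R^o => s^-1 : R^o) ^+ m) * (fun s : R^o => expR (- s^-1)) :> (R^o -> R^o).
    by apply/funext => s; rewrite !fctE.
  apply: is_derive_eq (is_deriveM dX dE) _.
  rewrite /flat t0 /GRing.scale /= fctE -exprVn.
  by case: m {dX} => [|m] /=; rewrite ?exprS; ring.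
- rewrite !flat_le0 ?ltW// mulr0 subr0.
  apply: (@near_eq_is_derive _ _ _ (cst (0 : R^o) : R^o -> R^o)).
    near=> s; rewrite flat_le0//; apply/ltW; near: s; exact: lt_nbhsl.
- rewrite !flat_le0// mulr0 subr0.
  have cv : (fun h : R => h^-1 *: ((flat m \o shift (0 : R^o)) (h *: (1 : R^o)) - flat m 0)) @ 0^' --> (0 : R^o).
    apply/cvgr0Pnorm_le => e e0.
    pose C : R := (m.+2)`!%:R.
    have C0 : 0 < C by rewrite ltr0n fact_gt0.
    exists (e / C) => /=; first by rewrite divr_gt0.
    move=> h /=; rewrite sub0r normrN => he h0.
    rewrite /= (flat_le0 m (lexx 0)) subr0 addr0 normrZ normfV /GRing.scale /= mulr1.
    rewrite ler_pdivrMl ?normr_gt0//; apply: (le_trans (flat_bound _ _)).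
    rewrite -/C expr2 mulrCA ler_pM2l ?normr_gt0// mulrC.
    by apply: ltW; rewrite -ltr_pdivlMr.
  split; first by apply/cvg_ex; exists 0.
  by apply/cvg_lim.
Unshelve. all: by end_near. Qed.
End flat_function.

Section Ck_flat.
Context {R : realType} {n : nat}.
Implicit Types (q : 'rV[R]_n -> R^o) (x y : 'rV[R]_n).

Lemma Ck_flat k m q x : Ck_at k q x -> Ck_at k (fun y => flat m (q y) : R^o) x.
Proof.
elim: k m q => [|k IH] m q cq.
  apply: (@continuous_comp _ _ _ q (flat m : R^o -> R^o)) => //.
  apply: differentiable_continuous; apply: (derivable1_diffP _ _).1.
  exact: (@ex_derive _ _ _ _ _ _ _ (is_derive_flat m (q x))).
apply: (@Ck_comp_step _ _ _ (flat m : R^o -> R^o)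
  (fun t : R^o => flat m.+2 t - m%:R * flat m.+1 t : R^o)) => //.
  by apply: (@nearW _ (nbhs x)) => y; exact: is_derive_flat.
have -> : (fun y => flat m.+2 (q y) - m%:R * flat m.+1 (q y)) =
  (fun y => (flat m.+2 (q y) : R^o) + (- m%:R : R^o) * flat m.+1 (q y) : R^o).
  by apply/funext => y; rewrite mulNr.
have cq' := Ck_S cq.
by apply: CkD; [exact: IH|apply: CkM; [exact: Ck_cst|exact: IH]].
Qed.

End Ck_flat.

Section step.
Context {R : realType}.
Implicit Types t : R.

(** The first summand of the denominator vanishes for t >= 1 and the second for t <= 1/2; these
    half-lines are disjoint, so the quotient stays smooth. *)
Definition step (t : R) : R := flat 0 (1 - t) / (flat 0 (1 - t) + flat 0 (t - 2^-1)).

Lemma step_den_gt0 t : 0 < flat 0 (1 - t) + flat 0 (t - 2^-1).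
Proof.
have [t1|t1] := ltP t 1.
  by rewrite ltr_pwDl ?flat_ge0// flat_gt0// subr_gt0.
by rewrite ltr_wpDl ?flat_ge0// flat_gt0//; lra.
Qed.

Lemma step1 t : t <= 2^-1 -> step t = 1.
Proof.
move=> t1; rewrite /step (flat_le0 0 (_ : t - 2^-1 <= 0)) ?addr0; last by lra.
by rewrite divff// gt_eqF// flat_gt0//; lra.
Qed.

Lemma step0 t : 1 <= t -> step t = 0.
Proof. by move=> t1; rewrite /step flat_le0 ?mul0r//; lra. Qed.

End step.

(** * Smooth functions and bump functions on a manifold *)

Section smooth_functions.
Context {R : realType} {n : nat} {M : manifold R n}.
Implicit Types (U V : set M) (f g : M -> R^o).

Lemma smooth_on_sum U (I : Type) (s : seq I) (F : I -> M -> R^o) :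
  (forall i, smooth_on U (F i)) -> smooth_on U (fun x => \sum_(i <- s) F i x).
Proof.
move=> sF; elim: s => [|i s IH].
  rewrite (_ : (fun _ => _) = fun=> 0); first exact: smooth_on_cst.
  by apply/funext => x; rewrite big_nil.
rewrite (_ : (fun _ => _) = fun x => F i x + \sum_(j <- s) F j x).
  exact: smooth_onD.
by apply/funext => x; rewrite big_cons.
Qed.

Lemma smooth_onV U f : smooth_on U f -> (forall x, U x -> f x != 0) ->
  smooth_on U (fun x => (f x)^-1 : R^o).
Proof.
by move=> sf f0 c cA y cy Uy k; apply: (CkV (q := f \o cinv c)); [exact: sf|exact: f0].
Qed.

Lemma smooth_on_flat m U f : smooth_on U f -> smooth_on U (fun x => flat m (f x) : R^o).
Proof.
by move=> sf c cA y cy Uy k; apply: (Ck_flat m (q := f \o cinv c)); exact: sf.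
Qed.

Lemma smooth_onB U f g : smooth_on U f -> smooth_on U g ->
  smooth_on U (fun x => f x - g x : R^o).
Proof.
move=> sf sg; rewrite (_ : (fun _ => _) = (fun x => f x + (-1 : R^o) * g x : R^o)).
  by apply: smooth_onD => //; apply: smooth_onM => //; exact: smooth_on_cst.
by apply/funext => x; rewrite mulN1r.
Qed.

Lemma smooth_on_step U f : smooth_on U f -> smooth_on U (fun x => step (f x) : R^o).
Proof.
move=> sf.
have s1 : smooth_on U (fun x => flat 0 (1 - f x) : R^o).
  apply: (smooth_on_flat 0 (f := fun x => 1 - f x)).
  by apply: smooth_onB => //; exact: smooth_on_cst.
have s2 : smooth_on U (fun x => flat 0 (f x - 2^-1) : R^o).
  apply: (smooth_on_flat 0 (f := fun x => f x - 2^-1)).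
  by apply: smooth_onB => //; exact: smooth_on_cst.
apply: (smooth_onM s1); apply: smooth_onV; first exact: smooth_onD.
by move=> x _; rewrite gt_eqF// step_den_gt0.
Qed.

Lemma smooth_on_chart (c : chart M n) j : atlas c ->
  smooth_on (cdom c) (fun x => cmap c x 0 j : R^o).
Proof. by move=> cA c' c'A y cy dy; apply: (atlas_smooth c'A cA). Qed.

End smooth_functions.

Section bump.
Context {R : realType} {n : nat} {M : manifold R n}.
Implicit Types (U : set M) (x : M).

(* The closed support of [f] is contained in [U]; [W] is a neighbourhood of the
   complement of [U]. *)
Definition supp_in (f : M -> R^o) U :=
  exists W, [/\ open W, W `|` U = setT & forall x, W x -> f x = 0].

Lemma supp_in_neq0 f U x : supp_in f U -> f x != 0 -> U x.
Proof.
move=> [W [_ WU fW]] /eqP fx.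
by have [/fW|//] : (W `|` U) x by rewrite WU.
Qed.

(** The cut-off is applied to the rescaled squared distance in a chart and extended by 0. It
    vanishes off the image [K] of a closed cube; [K] is compact, hence closed in the Hausdorff space
    M, so its complement is the open set on which the extension is locally 0. *)
Lemma bump_function U x0 : open U -> U x0 ->
  exists f : cinf M, supp_in f U /\ \forall x \near x0, f x = 1.
Proof.
move=> oU Ux0; have [c cA cx0] := atlas_cover x0.
pose y0 := cmap c x0.
have cy0 : ccod c y0 by exact: cmap_cod.
have : nbhs y0 (ccod c `&` (cinv c @^-1` U)).
  apply: filterI; first by apply: open_nbhs_nbhs; split; [exact: ccod_open|].
  apply: (cinv_continuous cy0); apply: open_nbhs_nbhs; split => //.
  by rewrite cmapK.
move=> /nbhs_ballP[e /= e0 eV].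
(* Half the radius, so that the closed cube of half-width [d] stays inside the open ball of radius
   [e] for the sup norm. *)
pose d := e / 2; have d0 : 0 < d by rewrite divr_gt0.
pose B := [set y : 'rV[R]_n | forall i, `[y0 0 i - d, y0 0 i + d]%classic (y 0 i)].
have BV y : B y -> ccod c y /\ U (cinv c y).
  move=> By; apply: eV; split=> // i j; rewrite ord1.
  have /andP[b1 b2] : y0 0 j - d <= y 0 j <= y0 0 j + d by have := By j; rewrite /= in_itv.
  rewrite /ball /= /ball_ ltr_norml; have : d < e by rewrite /d; lra.
  by move=> de; apply/andP; split; lra.
pose K := cinv c @` B.
have cK : closed K.
  apply: compact_closed; first exact: mspace_hausdorff.
  apply: continuous_compact.
    apply: continuous_in_subspaceT => y /set_mem /BV[cy _].
    exact: cinv_continuous.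
  apply: (@rV_compact R n (fun i => `[y0 0 i - d, y0 0 i + d]%classic)) => i.
  exact: segment_compact.
pose q (x : M) : R^o := \sum_j d^-2 * ((cmap c x 0 j - y0 0 j) * (cmap c x 0 j - y0 0 j)).
have sq : smooth_on (cdom c) q.
  apply: smooth_on_sum => j; apply: smooth_onM; first exact: smooth_on_cst.
  by apply: smooth_onM; apply: smooth_onB;
    [exact: smooth_on_chart|exact: smooth_on_cst|exact: smooth_on_chart|exact: smooth_on_cst].
pose f (x : M) : R^o := if `[< cdom c x >] then step (q x) else 0.
have fK x : ~ K x -> f x = 0.
  move=> Kx; rewrite /f; case: asboolP => // cx; apply: step0; rewrite leNgt.
  apply/negP => q1; apply: Kx; exists (cmap c x); last exact: cmapK.
  move=> j /=; rewrite in_itv /=.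
  have : d^-2 * ((cmap c x 0 j - y0 0 j) * (cmap c x 0 j - y0 0 j)) < 1.
    apply: le_lt_trans q1; rewrite /q (bigD1 j)//= lerDl sumr_ge0// => i _.
    by rewrite mulr_ge0 -?expr2 ?sqr_ge0// invr_ge0 sqr_ge0.
  rewrite mulrC ltr_pdivrMr ?exprn_gt0// mul1r -expr2 => h.
  have : `|cmap c x 0 j - y0 0 j| < d.
    by rewrite -(@ltr_pXn2r _ 2)// ?nnegrE ?ltW// real_normK// num_real.
  by rewrite ltr_norml => /andP[? ?]; apply/andP; split; lra.
have sf : smooth_on setT f.
  apply: smooth_on_local => x _; have [cx|cx] := pselect (cdom c x).
    exists (cdom c), (fun x => step (q x)); split=> //; first exact: cdom_open.
      exact: smooth_on_step.
    by move=> y cy; rewrite /f asboolT.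
  exists (~` K), (fun=> 0); split; first exact: closed_openC.
  - by move=> [y By yx]; apply: cx; rewrite -yx; apply: cinv_dom; case: (BV y By).
  - exact: smooth_on_cst.
  - by move=> y /fK.
exists (subelt (W := cinf_subspace M) sf); split.
  exists (~` K); split; first exact: closed_openC.
    apply/seteqP; split => // x _; have [[y By <-]|] := pselect (K x); last by left.
    by right; case: (BV y By).
  by move=> x /fK.
have nq : \forall x \near x0, q x < 2^-1.
  have q0 : q x0 = 0 by rewrite /q big1// => j _; rewrite subrr mulr0 mulr0.
  have cq : {for x0, continuous q}.
    move: (sq c cA (cmap c x0)); rewrite cmapK// => /(_ cy0 cx0 0%N) /= h.
    have h2 := @continuous_comp _ _ _ (cmap c) (q \o cinv c) x0 (cmap_continuous cx0) h.
    have E : \forall x \near x0, ((q \o cinv c) \o cmap c) x = q x.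
      apply: (@filterS _ (nbhs x0) _ _ _ _ (open_nbhs_nbhs (conj (@cdom_open _ _ _ c) cx0))).
      by move=> x cx; rewrite /= cmapK.
    rewrite /prop_for /continuous_at -(nbhs_singleton E).
    exact: (cvg_trans (@near_eq_cvg _ _ (nbhs x0) _ _ _ E) h2).
  have := cvgr_lt _ cq; apply; rewrite q0; lra.
have nc : \forall x \near x0, cdom c x.
  by apply: open_nbhs_nbhs; split => //; exact: cdom_open.
apply: (@filterS2 _ (nbhs x0) _ _ _ _ _ nc nq) => x cx qx.
by rewrite -[LHS]/(f x) /f asboolT// step1// ltW.
Qed.

End bump.

Section extension.
Context {R : realType} {n : nat} {M : manifold R n}.
Implicit Types (U : set M) (f g : cinf M).

Lemma cinfP f g : (forall x, f x = g x) -> f = g.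
Proof. by move=> fg; apply: val_inj; apply/funext => x; exact: fg. Qed.

Definition cinf_cst (a : R) : cinf M :=
  subelt (W := cinf_subspace M) (smooth_on_cst (U := setT) (a : R^o)).

Lemma supp_smooth U f (g : M -> R^o) : open U -> supp_in f U -> smooth_on U g ->
  smooth_on setT (fun x => f x * g x : R^o).
Proof.
move=> oU [W [oW WU fW]] sg; apply: smooth_on_local => x _.
have [Wx|Ux] : (W `|` U) x by rewrite WU.
  by exists W, (fun=> 0); split=> //; [exact: smooth_on_cst|move=> y /fW ->; rewrite mul0r].
exists U, (fun x => f x * g x); split=> //.
by apply: smooth_onM => //; apply: smooth_onS (cinf_smooth f).
Qed.

Lemma supp_smooth_sec (V : bundle M) U f (s : fam V) :
  open U -> supp_in f U -> smooth_sec U s ->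
  smooth_sec (b := V) setT (fun x => f x *: s x).
Proof.
move=> oU [W [oW WU fW]] ss; apply: smooth_sec_local => x _.
have [Wx|Ux] : (W `|` U) x by rewrite WU.
  by exists W, 0; split=> //; [exact: smooth_sec0|move=> y /fW ->; rewrite scale0r].
exists U, (fun x => f x *: s x); split=> //.
by apply: smooth_secZ => //; apply: smooth_onS (cinf_smooth f).
Qed.

Lemma cinf_nonzero_open f : open [set x | f x != 0].
Proof.
rewrite openE => x0 /= fx0.
have [c cA cx0] := atlas_cover x0.
have cf : {for x0, continuous (cinf_fun f : M -> R)}.
  move: (cinf_smooth f cA (cmap_cod cx0)); rewrite cmapK// => /(_ I 0%N) /= h.
  have h2 := @continuous_comp _ _ _ (cmap c) (cinf_fun f \o cinv c) x0 (cmap_continuous cx0) h.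
  have E : \forall x \near x0, ((cinf_fun f \o cinv c) \o cmap c) x = f x.
    apply: (@filterS _ (nbhs x0) _ _ _ _ (open_nbhs_nbhs (conj (@cdom_open _ _ _ c) cx0))).
    by move=> x cx; rewrite /= cmapK.
  rewrite /prop_for /continuous_at -(nbhs_singleton E).
  exact: (cvg_trans (@near_eq_cvg _ _ (nbhs x0) _ _ _ E) h2).
exact: (cvgr_neq0 _ cf).
Qed.

End extension.

(** * Gluing solutions of fibrewise linear problems *)

Section gluing.
Context {R : realType} {n : nat} {M : manifold R n} (V : bundle M).
Variable K : forall x : M, subspace (R^o * V x)%type.
Implicit Types (f g : cinf M) (s : gamma V) (p : nat -> cinf M * gamma V)
  (x y : M).

Let adm (q : cinf M * gamma V) := forall x, K x (q.1 x, q.2 x).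

(* A partition of unity without local finiteness conditions on the cover:
   [f_i prod_(j < i) (1 - f_j)] vanishes near every point where some earlier
   [f_j] is locally 1. *)
Let rest (p : nat -> cinf M * gamma V) : nat -> cinf M :=
  fix rest i := if i is j.+1 then cmul (rest j) (cinf_cst 1 - (p j).1) else cinf_cst 1.

Let partial (p : nat -> cinf M * gamma V) : nat -> gamma V :=
  fix partial i := if i is j.+1 then partial j + gscale (rest p j) (p j).2 else 0.

Let restS p i x : rest p i.+1 x = rest p i x * (1 - (p i).1 x). Proof. by []. Qed.

Let partialS p i x : partial p i.+1 x = partial p i x + rest p i x *: (p i).2 x.
Proof. by []. Qed.

(** The product of [rest p i] with the i-th function is [rest p i - rest p i.+1], so the
    coefficients telescope to [1 - rest p i]. Once some earlier function equals 1 at x, the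
    coefficient is 1 and the partial sums no longer change. *)
Let partialK p : (forall i, adm (p i)) ->
  forall i x, K x (1 - rest p i x, partial p i x).
Proof.
move=> ap; elim=> [|i IH] x.
  rewrite [X in 1 - X]/(1 : R) subrr; exact: subspace0.
have -> : (1 - rest p i.+1 x : R^o, partial p i.+1 x) =
    (1 - rest p i x : R^o, partial p i x) + rest p i x *: ((p i).1 x, (p i).2 x).
  rewrite partialS restS; congr (_, _) => /=.
  by rewrite /GRing.scale /=; ring.
by apply: subspaceD => //; apply: subspaceZ; exact: ap.
Qed.

Let rest0 p i x : (p i).1 x = 1 -> forall j, (i < j)%N -> rest p j x = 0.
Proof.
move=> pi1; elim=> // j IH; rewrite ltnS leq_eqVlt => /predU1P[<-|ij].
  by rewrite restS pi1 subrr mulr0.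
by rewrite restS IH // mul0r.
Qed.

Let partial_stable p i x : (p i).1 x = 1 ->
  forall j, (i < j)%N -> partial p j x = partial p i.+1 x.
Proof.
move=> pi1; elim=> // j IH; rewrite ltnS leq_eqVlt => /predU1P[<-//|ij].
by rewrite partialS (rest0 pi1 ij) scale0r addr0 IH.
Qed.

Let glue_seq (p : nat -> cinf M * gamma V) : (forall i, adm (p i)) ->
  (forall x, exists i, \forall y \near x, (p i).1 y = 1) ->
  exists s, forall x, K x (1, s x).
Proof.
move=> ap cp; have [N NP] := choice cp.
have N1 x : (p (N x)).1 x = 1 by exact: nbhs_singleton (NP x).
have E x j : (N x < j)%N -> partial p (N x).+1 x = partial p j x.
  by move=> Nj; rewrite (partial_stable (N1 x) Nj).
have ss : smooth_sec (b := V) setT (fun x => partial p (N x).+1 x).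
  apply: smooth_sec_local => x _.
  have : nbhs x [set y | (p (N x)).1 y = 1] := NP x.
  rewrite nbhsE => -[U [oU Ux] UP].
  exists U, (gamma_fun (partial p (N x).+1)); split=> //.
    by apply: smooth_secS (gamma_smooth _).
  (* An index past both [N x] and [N y] shows that the stable value at [y] is the one reached at
     [(N x).+1]; on [U] the glued section is thus a single partial sum. *)
  move=> y Uy; pose j := (maxn (N x) (N y)).+1.
  rewrite (E y j) ?ltnS ?leq_maxr//.
  by apply: (partial_stable (UP y Uy)); rewrite ltnS leq_maxl.
exists (to_gamma ss) => x.
have := partialK ap (N x).+1 x.
by rewrite (rest0 (N1 x)) // subr0.
Qed.

(** Every x has a basic open neighbourhood on which the function of some admissible pair is 1. There
    are countably many basic open sets; the numbers that correspond to no such set receive the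
    admissible pair (0, 0). *)
Let countable_cover :
  (forall x, exists q, adm q /\ \forall y \near x, q.1 y = 1) ->
  exists p : nat -> cinf M * gamma V, (forall i, adm (p i)) /\
    forall x, exists i, \forall y \near x, (p i).1 y = 1.
Proof.
move=> H; have [B /countable_injP[h hinj] [oB bB]] := mspace_second_countable M.
have : forall i, exists p' : cinf M * gamma V, adm p' /\ forall U q, B U -> h U = i -> adm q ->
    (forall y, U y -> q.1 y = 1) -> forall y, U y -> p'.1 y = 1.
  move=> i; have [[U [q [BU hU aq q1]]]|nU] := pselect (exists U q, [/\ B U, h U = i, adm q &
    forall y, U y -> q.1 y = 1]).
    exists q; split=> // U' q' BU' hU' _ _.
    by rewrite (hinj U' U) ?inE// hU' hU.
  exists (0, 0); split=> [x|U q BU hU aq q1]; first exact: subspace0.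
  by case: nU; exists U, q.
move=> /choice[p pP]; exists p; split=> [i|x]; first by case: (pP i).
have [q [aq q1]] := H x.
have [U [BU Ux] Uq] := bB x _ q1.
exists (h U); have [_ /(_ U q BU erefl aq Uq) Up] := pP (h U).
apply: (@filterS _ (nbhs x) _ _ _ Up).
by apply: open_nbhs_nbhs; split => //; exact: oB.
Qed.

(** [K x] is meant as the set of (c, s) such that s solves c times a linear problem at x, the
    solutions proper being the slice c = 1. A pair (f, s) is normalized to (g, (g/f) s), where the
    bump function g is supported in the open set where f is nonzero. *)
Lemma glue :
  (forall x0, exists f s, f x0 != 0 /\ forall x, K x (f x, s x)) ->
  exists s, forall x, K x (1, s x).
Proof.
move=> H; suff /countable_cover[p [ap cp]] :
  forall x, exists q, adm q /\ \forall y \near x, q.1 y = 1 by exact: glue_seq ap cp.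
move=> x0; have [f [s [fx0 Kfs]]] := H x0.
have [g [sg g1]] := bump_function (cinf_nonzero_open f) fx0.
have sgf : smooth_on (M := M) setT (fun x => g x * (f x)^-1 : R^o).
  apply: supp_smooth sg _; first exact: cinf_nonzero_open.
  by apply: smooth_onV => [|x //]; apply: smooth_onS (cinf_smooth f).
pose h : cinf M := subelt (W := cinf_subspace M) sgf.
have hf x : h x * f x = g x.
  rewrite -[h x]/(g x * (f x)^-1) -mulrA.
  have [W [_ WU gW]] := sg; have [Wx|Ux] : (W `|` [set x | f x != 0]) x by rewrite WU.
    by rewrite gW // mul0r.
  by rewrite mulVf ?mulr1.
exists (cmul h f, gscale h s); split=> [x|].
  by rewrite -[(_, _)]/(h x *: (f x, s x)); apply: subspaceZ.
apply: (@filterS _ (nbhs x0) _ _ _ _ g1) => x gx.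
by rewrite -[LHS]/(h x * f x) hf.
Qed.

End gluing.

(** * Frames *)

Section separation.
Context {R : realType} (V : lmodType R).

(** Functionals are added one at a time. As long as d < r of them are chosen, some nonzero
    combination v of the [e i] is killed by all of them, and a functional that does not kill v is
    independent of the others. *)
Lemma separating_unitmx r (e : 'I_r -> V) (F : Type) (ev : F -> V -> R) :
  (forall l a u v, ev l (a *: u + v) = a * ev l u + ev l v) ->
  (forall v, v != 0 -> exists l, ev l v != 0) ->
  (forall a : 'I_r -> R, \sum_i a i *: e i = 0 -> forall i, a i = 0) ->
  exists l : 'I_r -> F, \matrix_(i, j) ev (l i) (e j) \in unitmx.
Proof.
move=> evL sep free.
have ev0 l : ev l 0 = 0.
  by have := evL l (-1) 0 0; rewrite scaler0 add0r mulN1r addNr.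
have evS l (a : 'I_r -> R) : ev l (\sum_i a i *: e i) = \sum_i a i * ev l (e i).
  by elim/big_rec2: _ => [|i y1 y2 _ <-]; [exact: ev0|exact: evL].
suff H d : (d <= r)%N -> exists l : 'I_d -> F, row_free (\matrix_(i, j) ev (l i) (e j)).
  by have [l lf] := H r (leqnn r); exists l; rewrite -row_free_unit.
elim: d => [|d IH] dr.
  have l : 'I_0 -> F by case.
  by exists l; apply: inj_row_free => v _; apply/rowP; case.
have [l lf] := IH (ltnW dr); pose N := \matrix_(i, j) ev (l i) (e j).
have /rowV0Pn[c cN c0] : kermx N^T != 0.
  rewrite -mxrank_eq0 mxrank_ker mxrank_tr.
  by move: lf; rewrite /row_free -/N => /eqP ->; rewrite subn_eq0 -ltnNge.
have {}cN : c *m N^T = 0 by apply/sub_kermxP.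
pose v := \sum_i c 0 i *: e i.
have [l0 l0v] : exists l0, ev l0 v != 0.
  apply: sep; apply: contra_neq c0 => v0; apply/rowP => i.
  by rewrite mxE (free _ v0).
pose l' (i : 'I_d.+1) := if unlift ord0 i is Some j then l j else l0.
exists l'; apply: inj_row_free => x xN.
have xE j : x 0 ord0 * ev l0 (e j) + \sum_i x 0 (lift ord0 i) * ev (l i) (e j) = 0.
  move/rowP: xN => /(_ j); rewrite !mxE big_ord_recl !mxE /l' unlift_none => xN0.
  rewrite -[RHS]xN0; congr (_ + _).
  by apply: eq_bigr => i _; rewrite !mxE liftK.
(* Contracting the relation [xE] with [c] annihilates the old rows and leaves the coefficient of
   [l0] times the nonzero number [ev l0 v]. *)
have x0 : x 0 ord0 = 0.
  have : \sum_j c 0 j * (x 0 ord0 * ev l0 (e j) +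
      \sum_i x 0 (lift ord0 i) * ev (l i) (e j)) = 0.
    by rewrite big1// => j _; rewrite xE mulr0.
  under eq_bigr do rewrite mulrDr mulrCA mulr_sumr.
  rewrite big_split /= -mulr_sumr -evS exchange_big /= [X in _ + X]big1 ?addr0.
    by move/eqP; rewrite mulf_eq0 (negbTE l0v) orbF => /eqP.
  move=> i _; under eq_bigr do rewrite mulrCA.
  rewrite -mulr_sumr; move/rowP: cN => /(_ i); rewrite !mxE.
  by under eq_bigr do rewrite !mxE; move=> ->; rewrite mulr0.
have y0 : \row_i x 0 (lift ord0 i) = 0.
  apply: (row_free_inj lf); rewrite mul0mx; apply/rowP => j; rewrite !mxE.
  by rewrite -[RHS](xE j) x0 mul0r add0r; apply: eq_bigr => i _; rewrite !mxE.
apply/rowP => i; rewrite [RHS]mxE; case: (unliftP ord0 i) => [j|] -> //.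
by move/rowP: y0 => /(_ j); rewrite !mxE.
Qed.

End separation.

Section smooth_matrices.
Context {R : realType} {n : nat} {M : manifold R n}.

Lemma smooth_on_prod (U : set M) (I : Type) (s : seq I) (F : I -> M -> R^o) :
  (forall i, smooth_on U (F i)) -> smooth_on U (fun x => \prod_(i <- s) (F i x : R) : R^o).
Proof.
move=> sF; elim: s => [|i s IH].
  rewrite (_ : (fun _ => _) = fun=> 1); first exact: smooth_on_cst.
  by apply/funext => x; rewrite big_nil.
rewrite (_ : (fun _ => _) = fun x => F i x * \prod_(j <- s) (F j x : R)).
  exact: smooth_onM.
by apply/funext => x; rewrite big_cons.
Qed.

Lemma smooth_on_det (U : set M) r (N : M -> 'M[R]_r) :
  (forall i j, smooth_on U (fun x => N x i j : R^o)) ->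
  smooth_on U (fun x => \det (N x) : R^o).
Proof.
move=> sN; apply: smooth_on_sum => s; apply: smooth_onM; first exact: smooth_on_cst.
by apply: smooth_on_prod => i; exact: sN.
Qed.

Lemma smooth_on_adj (U : set M) r (N : M -> 'M[R]_r) :
  (forall i j, smooth_on U (fun x => N x i j : R^o)) ->
  forall i j, smooth_on U (fun x => (\adj (N x)) i j : R^o).
Proof.
move=> sN i j; rewrite (_ : (fun _ => _) = (fun x => (-1) ^+ (j + i) *
    \det (row' j (col' i (N x))))); last by apply/funext => x; rewrite mxE.
apply: smooth_onM; first exact: smooth_on_cst.
apply: smooth_on_det => a b.
by rewrite (_ : (fun _ => _) = (fun x => N x (lift j a) (lift i b)));
  [exact: sN|apply/funext => x; rewrite !mxE].
Qed.

End smooth_matrices.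

Section frames.
Context {R : realType} {n : nat} {M : manifold R n} {V : bundle M} {r : nat}.
Variable W : subbundle V r.

(** The local frame is multiplied by a bump function [f] to become global; it remains a frame
    wherever [f] does not vanish. *)
Lemma local_frame x0 : exists (e : 'I_r -> sgamma W) (f : cinf M), f x0 != 0 /\
  forall x, f x != 0 ->
    (forall t, W x t -> exists a : 'I_r -> R, t = \sum_i a i *: (e i : gamma V) x) /\
    (forall a : 'I_r -> R, \sum_i a i *: (e i : gamma V) x = 0 -> forall i, a i = 0).
Proof.
have [U [e [oU Ux0 se be]]] := sfib_frame W x0.
have [f [sf f1]] := bump_function oU Ux0.
have fU x : f x != 0 -> U x by exact: supp_in_neq0.
have eW i x : W x (f x *: e i x).
  have [->|/fU/be[We _]] := eqVneq (f x) 0; first by rewrite scale0r; exact: subspace0.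
  by apply: subspaceZ; exact: We.
pose e' i : sgamma W := to_sgamma (s := to_gamma (supp_smooth_sec oU sf (se i))) (eW i).
have e'E i x : (e' i : gamma V) x = f x *: e i x by [].
have fx0 : f x0 = 1 by exact: nbhs_singleton f1.
exists e', f; split=> [|x fx]; first by rewrite fx0 oner_neq0.
have [We Be] := be x (fU x fx); split=> [t Wt|a a0 i].
  have [a [-> _]] := Be t Wt; exists (fun i => a i / f x).
  by apply: eq_bigr => i _; rewrite e'E scalerA divfK.
have [b [_ bu]] := Be 0 (subspace0 _).
have : (fun i => a i * f x) = (fun=> 0).
  rewrite -(bu (fun i => a i * f x)) -?(bu (fun=> 0))//.
    by rewrite big1// => j _; rewrite scale0r.
  by rewrite -[LHS]a0; apply: eq_bigr => j _; rewrite e'E scalerA.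
by move=> /(congr1 (fun g => g i)) /eqP; rewrite mulf_eq0 (negbTE fx) orbF => /eqP.
Qed.

Lemma sgamma_sum (I : Type) (s : seq I) (F : I -> sgamma W) :
  (\sum_(i <- s) F i : sgamma W) = \sum_(i <- s) (F i : gamma V) :> gamma V.
Proof. by elim/big_rec2: _ => // i y1 y2 _ <-. Qed.

Lemma sgammaP (s t : sgamma W) : s = t :> gamma V -> s = t.
Proof. exact: val_inj. Qed.

Lemma sgamma_through x0 (t : V x0) : W x0 t -> exists s : sgamma W, (s : gamma V) x0 = t.
Proof.
have [e [f [fx0 /(_ x0 fx0)[span _]]]] := local_frame x0.
move=> /span[a ->]; exists (\sum_i a i *: e i).
elim/big_rec2: _ => // i s t' _ <-.
by [].
Qed.

Lemma sgamma_nonzero : (0 < r)%N -> forall x0, exists s : sgamma W, (s : gamma V) x0 != 0.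
Proof.
move=> r0 x0; have [e [f [fx0 /(_ x0 fx0)[_ free]]]] := local_frame x0.
pose i0 := Ordinal r0; exists (e i0); apply/eqP => e0.
have := free (fun i => (i == i0)%:R); rewrite (bigD1 i0)// eq_refl scale1r e0 /= add0r.
rewrite big1 => [|i /negbTE ->]; last by rewrite scale0r.
by move=> /(_ erefl i0) /eqP; rewrite eqxx oner_eq0.
Qed.

End frames.

Section vector_bundle_dual.
Context {R : realType} {n : nat} {M : manifold R n} {k : nat} (E : vector_bundle M k).

Definition functional (V : bundle M) (l : forall x, V x -> R) :=
  (forall x (a : R) (s t : V x), l x (a *: s + t) = a * l x s + l x t) /\
  (forall s : gamma V, smooth_on setT (fun x => l x (s x) : R^o)).

(** A local frame and its coordinates each need a bump factor to become global, so the identity is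
    reproduced up to the square of the bump function. *)
Lemma vector_bundle_dual x0 : exists (e : 'I_k -> gamma E) (l : 'I_k -> forall x, E x -> R)
    (f : cinf M),
  [/\ f x0 != 0, forall b, functional (V := E) (l b) &
      forall x (u : E x), \sum_b l b x u *: e b x = f x *: u].
Proof.
have [i ix0] := vdom_cover E x0; have oi := vdom_open i.
have [f [sf f1]] := bump_function oi ix0.
pose h (b : 'I_k) (x : M) : E x := xget 0 [set u | vcoord i x u = delta_mx 0 b].
have hE b x : vdom i x -> vcoord i x (h b x) = delta_mx 0 b.
  move=> /(vcoord_bij)[g _ gK]; rewrite /h; case: xgetP => [u -> //|].
  by move=> /(_ (g (delta_mx 0 b)))/(_ (gK _)).
have sh b : smooth_sec (b := E) (vdom i) (h b).
  move=> j c; have [g [sg gE]] := vcoord_smooth i j.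
  apply: smooth_on_local => x xij; exists (vdom i `&` vdom j), (fun x => g x b c); split=> //.
    by apply: openI => //; exact: vdom_open.
  move=> y [yi yj]; rewrite (gE y yi yj) hE //.
  by rewrite -rowE mxE.
pose e b : gamma E := to_gamma (supp_smooth_sec oi sf (sh b)).
pose l (b : 'I_k) (x : M) (u : E x) : R := f x * vcoord i x u 0 b.
have fx0 : f x0 = 1 by exact: nbhs_singleton f1.
exists e, l, (cmul f f); split=> [|b|x u].
- by rewrite -[cmul f f x0]/(f x0 * f x0) fx0 mulr1 oner_neq0.
- split=> [x a s t|s].
    by rewrite /l linearP !mxE mulrDr mulrCA.
  apply: (supp_smooth oi sf); have := gamma_smooth s i b.
  by rewrite setTI.
- rewrite -[cmul f f x]/(f x * f x); have [fx|fx] := eqVneq (f x) 0.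
    rewrite fx mul0r scale0r big1// => b _.
    by rewrite /l fx mul0r scale0r.
  have ix := supp_in_neq0 sf fx; have /bij_inj := vcoord_bij ix; apply.
  transitivity (vcoord i x (\sum_b (l b x u * f x) *: h b x)).
    by congr (vcoord i x _); apply: eq_bigr => b _; rewrite -scalerA.
  rewrite linear_sum linearZ /= [in RHS](row_sum_delta (vcoord i x u)) scaler_sumr.
  apply: eq_bigr => b _; rewrite linearZ /= hE //.
  by rewrite /l !scalerA mulrAC.
Qed.

End vector_bundle_dual.

Section evaluation.
Context {R : realType} {n : nat} {M : manifold R n}.

Lemma gammaD (V : bundle M) (s t : gamma V) x : (s + t : gamma V) x = s x + t x.
Proof. by []. Qed.
Lemma gammaN (V : bundle M) (s : gamma V) x : (- s : gamma V) x = - s x.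
Proof. by []. Qed.
Lemma gammaZ (V : bundle M) (a : R) (s : gamma V) x : (a *: s : gamma V) x = a *: s x.
Proof. by []. Qed.
Lemma gscaleE (V : bundle M) f (s : gamma V) x : gscale f s x = f x *: s x.
Proof. by []. Qed.
Lemma gamma_sum (V : bundle M) (I : Type) (s : seq I) (F : I -> gamma V) x :
  (\sum_(i <- s) F i : gamma V) x = \sum_(i <- s) F i x.
Proof. by elim/big_rec2: _ => // i y1 y2 _ <-. Qed.

Variable E : bundle M.

Lemma gauge_eval_comb x (a : R) (d d' : gauge E x) u :
  gauge_op (a *: d + d') u = a *: gauge_op d u + gauge_op d' u.
Proof. by []. Qed.
Lemma gauge_symbol_comb x (a : R) (d d' : gauge E x) :
  gauge_symbol (a *: d + d') = a *: gauge_symbol d + gauge_symbol d'.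
Proof. by []. Qed.

Lemma gauge_symbolZ x (a : R) (d : gauge E x) :
  gauge_symbol (a *: d) = a *: gauge_symbol d.
Proof. exact: erefl. Qed.
Lemma gauge_evalZ x (a : R) (d : gauge E x) u : gauge_op (a *: d) u = a *: gauge_op d u.
Proof. exact: erefl. Qed.
Lemma omni_fst_comb f (X Y : gamma (omni E)) x :
  ((gscale f X + Y : gamma (omni E)) x).1 = f x *: (X x).1 + (Y x).1.
Proof. exact: erefl. Qed.
Lemma omni_snd_comb f (X Y : gamma (omni E)) x :
  ((gscale f X + Y : gamma (omni E)) x).2 = f x *: (X x).2 + (Y x).2.
Proof. exact: erefl. Qed.
Lemma jet0E x : (0 : jet E x) = jet_of x 0.
Proof. by rewrite -(scale0r (jet_of x 0)) -jet_ofZ scale0r. Qed.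

End evaluation.

(** * Functionals on TM + E induced by the kernel of b *)

Section omni_functionals.
Context {R : realType} {n : nat} {M : manifold R n} {k : nat} (E : vector_bundle M k).

(* [l (x) w : calT E -> E] is induced by a section of the kernel of [b]. *)
Definition omni_functional (l : forall x, calT E x -> R) :=
  functional (V := calT E) l /\
  forall w : gamma E, exists X : gamma (omni E), forall x,
    [/\ gauge_symbol (X x).1 = 0, jet_proj (X x).2 = 0 &
        forall (t : calT E x) (u : gamma E) (r : gauge E x), u x = t.2 -> gauge_symbol r = t.1 ->
          gauge_op (X x).1 u + jet_pairing (X x).2 r = l x t *: w x].

(** Here dg tensor w is the jet section d(gw) - g dw, which lies in the kernel of p. *)
Lemma omni_functional_d (g : cinf M) : omni_functional (fun x t => (t.1 : tangent x) g).
Proof.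
split; first split=> [x a s t|s]; first exact: erefl.
  exact: (gamma_smooth (gfst s) g).
move=> w; exists (gpair (0 : gamma (gauge_bundle E)) (jet_sec (gscale g w) - gscale g (jet_sec w))).
move=> x; split=> [||t u r _ rt]; first exact: erefl.
  rewrite -[X in jet_proj X]/(jet_of x (gscale g w) - g x *: jet_of x w).
  by rewrite -scaleN1r jet_projD !jet_projZ !jet_projE gscaleE scaleN1r subrr.
rewrite -[X in jet_pairing X]/(jet_of x (gscale g w) - g x *: jet_of x w).
rewrite -[gauge_op _ _]/(0 : E x) add0r -scaleN1r jet_pairingD !jet_pairingZ !jet_pairingE.
by rewrite gauge_leibniz rt scaleN1r addrAC subrr add0r.
Qed.

(** Here l tensor w is an endomorphism of [E], that is, a section of DE with zero symbol. *)
Lemma omni_functional_coord (l : forall x, E x -> R) : functional (V := E) l ->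
  omni_functional (fun x t => l x t.2).
Proof.
move=> [lL ls]; split; first split=> [x a s t|s]; first exact: lL.
  exact: (ls (gsnd s)).
move=> w.
have gw x : gauge_subspace E x ((fun u : gamma E => l x (u x) *: w x), (0 : tangent x)).
  split=> [a u v|f u].
    by rewrite -[LHS]/(l x (a *: (u : gamma E) x + (v : gamma E) x) *: w x) lL scalerDl -scalerA.
  rewrite -[LHS]/(l x (f x *: u x) *: w x) -[f x *: u x]addr0 lL.
  have l0 : l x 0 = 0 by have := lL x (-1) 0 0; rewrite scaler0 add0r mulN1r addNr.
  by rewrite l0 addr0 -scalerA -[X in _ + X *: _]/(0 : R) scale0r addr0.
have sw : gauge_smooth setT (fun x => subelt (W := gauge_subspace E x) (gw x)).
  split=> [u|]; last exact: smooth_sec0.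
  by apply: (smooth_secZ (b := E)) => //; [exact: openT|exact: gamma_smooth].
exists (gpair (to_gamma (V := gauge_bundle E) sw) (0 : gamma (jet_bundle E))).
move=> x.
split=> [||t u r ut _] /=; first exact: erefl.
  by rewrite -[X in jet_proj X]/(0 : jet E x) jet0E jet_projE.
rewrite -[X in jet_pairing X]/(0 : jet E x) jet0E jet_pairingE gauge_op0 addr0.
by rewrite -ut.
Qed.

Lemma omni_functional0 : omni_functional (fun x t => 0).
Proof.
split; first by split=> [x a s t|s]; [rewrite mulr0 addr0|exact: smooth_on_cst].
move=> w; exists 0 => x.
split=> [||t u r _ _]; first exact: erefl.
  by rewrite -[X in jet_proj X]/(0 : jet E x) jet0E jet_projE.
by rewrite -[X in jet_pairing X]/(0 : jet E x) jet0E jet_pairingE gauge_op0 addr0 scale0r.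
Qed.

Lemma omni_functional_comb (f : cinf M) l l' : omni_functional l -> omni_functional l' ->
  omni_functional (fun x t => f x * l x t + l' x t).
Proof.
move=> [[lL ls] lX] [[lL' ls'] lX']; split; first split=> [x a s t|s].
- by rewrite lL lL'; ring.
- by apply: smooth_onD => //; apply: smooth_onM => //; exact: cinf_smooth.
move=> w; have [X XP] := lX w; have [X' XP'] := lX' w.
exists (gscale f X + X') => x.
have [s1 p1 e1] := XP x; have [s2 p2 e2] := XP' x.
split=> [||t u r ut rt].
- by rewrite omni_fst_comb gauge_symbol_comb s1 s2 scaler0 addr0.
- by rewrite omni_snd_comb jet_projD jet_projZ p1 p2 scaler0 addr0.
rewrite omni_snd_comb jet_pairingD jet_pairingZ omni_fst_comb gauge_eval_comb.
by rewrite addrACA -scalerDr (e1 _ _ _ ut rt) (e2 _ _ _ ut rt) scalerDl -scalerA.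
Qed.

Lemma omni_functional_sum m (f : 'I_m -> cinf M) l : (forall i, omni_functional (l i)) ->
  omni_functional (fun x t => \sum_i f i x * l i x t).
Proof.
move=> lP; elim: (index_enum _) => [|i s IH].
  rewrite (_ : (fun _ => _) = (fun x t => 0)); first exact: omni_functional0.
  by apply: functional_extensionality_dep => x; apply/funext => t; rewrite big_nil.
rewrite (_ : (fun _ => _) = (fun x t => f i x * l i x t + \sum_(i <- s) f i x * l i x t)).
  exact: omni_functional_comb.
by apply: functional_extensionality_dep => x; apply/funext => t; rewrite big_cons.
Qed.

(** A tangent vector is a derivation of the smooth functions, so a nonzero one is detected by some
    g; a nonzero vector of [E] is detected by a fibre coordinate. *)
Lemma omni_functional_separating x (t : calT E x) : t != 0 ->
  exists l, omni_functional l /\ l x t != 0.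
Proof.
move=> t0; apply: contrapT => nl.
have {}nl l : omni_functional l -> l x t = 0.
  by move=> lP; apply/eqP; apply: contrapT => /negP lt; apply: nl; exists l.
move/eqP: t0; apply; case: t nl => v e nl; congr (_, _).
  by apply: val_inj; apply/funext => g; exact: nl _ (omni_functional_d g).
have [b [l [f [fx0 lP le]]]] := vector_bundle_dual E x.
have : f x *: e = 0.
  rewrite -le big1// => i _.
  by rewrite (nl _ (omni_functional_coord (lP i))) scale0r.
by move/eqP; rewrite scaler_eq0 (negbTE fx0) => /eqP.
Qed.

End omni_functionals.

Section dual_frames.
Context {R : realType} {n : nat} {M : manifold R n} {k : nat} (E : vector_bundle M k).
Context {r : nat} (A : subbundle (calT E) r).

(** Cramer's rule without division: functionals whose matrix N on the frame is invertible at [x0]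
    are replaced by adj(N) times them, which is dual to the frame up to det(N). The extra factor [f]
    makes both sides vanish where the frame may degenerate. *)
Lemma dual_frame x0 : exists (e : 'I_r -> sgamma A) (l : 'I_r -> forall x, calT E x -> R)
    (f : cinf M),
  [/\ f x0 != 0, forall i, omni_functional (E := E) (l i),
      forall x (t : calT E x), A x t -> f x *: t = \sum_i l i x t *: (e i : gamma (calT E)) x &
      forall x i j, l i x ((e j : gamma (calT E)) x) = f x *+ (i == j)].
Proof.
have [e [f [fx0 frame]]] := local_frame A x0.
pose ev (l : {l : forall x, calT E x -> R | omni_functional (E := E) l}) (t : calT E x0) :=
  sval l x0 t.
have [l lU] : exists l, \matrix_(i, j) ev (l i) ((e j : gamma (calT E)) x0) \in unitmx.
  apply: separating_unitmx (proj2 (frame x0 fx0)) => [l a s t|t t0].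
    by case: (svalP l) => -[lL _] _; exact: lL.
  have [l [lP lt]] := omni_functional_separating t0.
  by exists (exist _ l lP).
pose N (x : M) := \matrix_(i, j) sval (l i) x ((e j : gamma (calT E)) x).
have sN i j : smooth_on setT (fun x => N x i j : R^o).
  rewrite (_ : (fun _ => _) = fun x => sval (l i) x ((e j : gamma (calT E)) x)).
    by case: (svalP (l i)) => -[_ ls] _; exact: ls.
  by apply/funext => x; rewrite mxE.
pose g i j : cinf M := subelt (W := cinf_subspace M)
  (smooth_onM (cinf_smooth f) (smooth_on_adj sN i j)).
pose l' i (x : M) (t : calT E x) := \sum_j g i j x * sval (l j) x t.
pose f' : cinf M := subelt (W := cinf_subspace M)
  (smooth_onM (cinf_smooth f) (smooth_on_det sN)).
have l'e x i j : l' i x ((e j : gamma (calT E)) x) = f' x *+ (i == j).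
  rewrite -[f' x]/(f x * \det (N x)) -mulrnAr.
  have := mul_adj_mx (N x) => /matrixP/(_ i j); rewrite !mxE => <-.
  rewrite mulr_sumr; apply: eq_bigr => m _.
  by rewrite -[g i m x]/(f x * (\adj (N x)) i m) -mulrA [N x m j]mxE.
have l'0 i x t : f x = 0 -> l' i x t = 0.
  move=> fx; rewrite /l' big1 // => j _.
  by rewrite -[g i j x]/(f x * (\adj (N x)) i j) fx !mul0r.
have l'P i : omni_functional (E := E) (l' i).
  by apply: omni_functional_sum => j; exact: svalP.
exists e, l', f'; split=> //.
  rewrite -[f' x0]/(f x0 * \det (N x0)) mulf_neq0//.
  by move: lU; rewrite unitmxE unitfE.
move=> x t At; have [fx|fx] := eqVneq (f x) 0.
  rewrite -[f' x]/(f x * \det (N x)) fx mul0r scale0r big1// => i _.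
  by rewrite l'0// scale0r.
have [/(_ t At)[a ->] _] := frame x fx.
rewrite scaler_sumr; apply: eq_bigr => i _; rewrite scalerA; congr (_ *: _).
have l'S (b : 'I_r -> R) (h : 'I_r -> calT E x) :
    l' i x (\sum_j b j *: h j) = \sum_j b j * l' i x (h j).
  have [[lL _] _] := l'P i.
  have l0 : l' i x 0 = 0 by have := lL x (-1) 0 0; rewrite scaler0 add0r mulN1r addNr.
  by elim/big_rec2: _ => [|j y1 y2 _ <-]; [exact: l0|exact: lL].
rewrite l'S (bigD1 i)//= l'e eqxx mulr1n big1 ?addr0 1?mulrC// => j ji.
by rewrite l'e eq_sym (negbTE ji) mulr0n mulr0.
Qed.

End dual_frames.

(** * Lie derivatives *)

(* Reflection for the tactic [zmod], which decides linear identities with integer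
   coefficients in an abelian group. *)
Inductive zexpr := ZVar of nat | ZAdd of zexpr & zexpr | ZOpp of zexpr | ZZero.

Fixpoint zcoef (e : zexpr) (i : nat) : int :=
  match e with
  | ZVar j => (i == j)%:Z
  | ZAdd a b => zcoef a i + zcoef b i
  | ZOpp a => - zcoef a i
  | ZZero => 0
  end.

Section zexpr.
Variable W : zmodType.
Implicit Types (env : seq W) (e : zexpr).

Fixpoint zeval env e : W :=
  match e with
  | ZVar j => env`_j
  | ZAdd a b => zeval env a + zeval env b
  | ZOpp a => - zeval env a
  | ZZero => 0
  end.

Lemma zevalE env e : zeval env e = \sum_(i < size env) env`_i *~ zcoef e i.
Proof.
elim: e => [j|a IHa b IHb|a IHa|] /=.
- have [jn|nj] := ltnP j (size env).
    rewrite (bigD1 (Ordinal jn))//= eqxx mulr1z big1 ?addr0// => i.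
    by rewrite -val_eqE /= => /negbTE ->.
  rewrite nth_default// big1// => i _.
  by rewrite ltn_eqF// (leq_trans (ltn_ord i)).
- by rewrite IHa IHb -big_split; apply: eq_bigr => i _; rewrite mulrzDr.
- by rewrite IHa -sumrN; apply: eq_bigr => i _; rewrite mulrNz.
- by rewrite big1.
Qed.

Lemma zeval_eq env e e' :
  all (fun i => zcoef e i == zcoef e' i) (iota 0 (size env)) -> zeval env e = zeval env e'.
Proof.
move=> /allP H; rewrite !zevalE; apply: eq_bigr => i _.
by rewrite (eqP (H i _))// mem_iota add0n leq0n ltn_ord.
Qed.

End zexpr.

(* The second branch identifies terms differing by the inferred module structure. *)
Ltac zmod_same a b :=
  lazymatch constr:((a, b)) with
  | (?x, ?x) => constr:(true)
  | (?c *: ?x, ?c *: ?x) => constr:(true)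
  | _ => constr:(false)
  end.
Ltac zmod_index a env :=
  lazymatch env with
  | ?b :: ?s => lazymatch zmod_same a b with
                | true => constr:(0%N)
                | false => let i := zmod_index a s in constr:(i.+1)
                end
  end.
Ltac zmod_mem a env :=
  lazymatch env with
  | [::] => constr:(false)
  | ?b :: ?s => lazymatch zmod_same a b with
                | true => constr:(true)
                | false => zmod_mem a s
                end
  end.
Ltac zmod_atoms t env :=
  lazymatch t with
  | ?a + ?b => let env := zmod_atoms a env in zmod_atoms b env
  | - ?a => zmod_atoms a env
  | 0 => env
  | _ => lazymatch zmod_mem t env with
         | true => env
         | false => constr:(t :: env)
         end
  end.
Ltac zmod_reify t env :=
  lazymatch t with
  | ?a + ?b => let x := zmod_reify a env in let y := zmod_reify b env in constr:(ZAdd x y)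
  | - ?a => let x := zmod_reify a env in constr:(ZOpp x)
  | 0 => constr:(ZZero)
  | _ => let i := zmod_index t env in constr:(ZVar i)
  end.
Ltac zmod :=
  lazymatch goal with
  | |- @eq ?T ?x ?y =>
    let env := zmod_atoms x (@nil T) in
    let env := zmod_atoms y env in
    let e := zmod_reify x env in
    let e' := zmod_reify y env in
    refine (@zeval_eq _ env e e' _); vm_compute; reflexivity
  end.

(** Lets [zmod] use a hypothesis a = b: the remaining identity a - b = c - d is unconditional. *)
Lemma zmod_transfer (W : zmodType) (a b c d : W) : a = b -> a - b = c - d -> c = d.
Proof. by move=> ->; rewrite subrr => /esym/eqP; rewrite subr_eq0 => /eqP. Qed.

Section jets.
Context {R : realType} {n : nat} {M : manifold R n} (E : bundle M).
Implicit Types (d r : gamma (gauge_bundle E)) (m : gamma (jet_bundle E)) (u : gamma E).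

Lemma dactD d u v : dact d (u + v) = dact d u + dact d v.
Proof. by rewrite -[u in LHS]scale1r dact_lin scale1r. Qed.
Lemma dact0 d : dact d 0 = 0.
Proof. by apply: (addrI (dact d 0)); rewrite -dactD !addr0. Qed.
Lemma dactZ d (a : R) u : dact d (a *: u) = a *: dact d u.
Proof. by rewrite -[a *: u]addr0 dact_lin dact0 addr0. Qed.
Lemma dactN d u : dact d (- u) = - dact d u.
Proof. by rewrite -scaleN1r dactZ scaleN1r. Qed.
Lemma dact_sum d (I : Type) (s : seq I) (F : I -> gamma E) :
  dact d (\sum_(i <- s) F i) = \sum_(i <- s) dact d (F i).
Proof. by elim/big_rec2: _ => [|i y1 y2 _ <-]; [exact: dact0|exact: dactD]. Qed.

Lemma gscaleDr (V : bundle M) f (s t : gamma V) : gscale f (s + t) = gscale f s + gscale f t.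
Proof. by apply: gammaP => x; rewrite gscaleE !gammaD scalerDr. Qed.
Lemma gscaleNr (V : bundle M) f (s : gamma V) : gscale f (- s) = - gscale f s.
Proof. by apply: gammaP => x; rewrite gscaleE !gammaN scalerN. Qed.

Lemma jpairingD m m' d : jpairing (m + m') d = jpairing m d + jpairing m' d.
Proof. by apply: gammaP => x; exact: jet_pairingD. Qed.
Lemma jpairing_gscale f m d : jpairing (gscale f m) d = gscale f (jpairing m d).
Proof. by apply: gammaP => x; exact: jet_pairingZ. Qed.
Lemma jpairingZ (a : R) m d : jpairing (a *: m) d = a *: jpairing m d.
Proof. by apply: gammaP => x; exact: jet_pairingZ. Qed.
Lemma jpairing0 d : jpairing 0 d = 0.
Proof. by rewrite -(scale0r 0) jpairingZ !scale0r. Qed.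
Lemma jpairingN m d : jpairing (- m) d = - jpairing m d.
Proof. by rewrite -scaleN1r jpairingZ scaleN1r. Qed.
Lemma jpairing_sum (I : Type) (s : seq I) (F : I -> gamma (jet_bundle E)) d :
  jpairing (\sum_(i <- s) F i) d = \sum_(i <- s) jpairing (F i) d.
Proof. by elim/big_rec2: _ => [|i y1 y2 _ <-]; [exact: jpairing0|exact: jpairingD]. Qed.
Lemma jpairing_jet u d : jpairing (jet_sec u) d = dact d u.
Proof. by apply: gammaP => x; exact: jet_pairingE. Qed.

(** Smoothness of jets provides only local combinations of first jets; cut off by a bump function,
    they become an identity between global sections. *)
Lemma jet_bumped_sum m x0 : exists (f : cinf M) (s : seq (cinf M * gamma E)),
  f x0 != 0 /\ gscale f m = \sum_(q <- s) gscale q.1 (jet_sec q.2).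
Proof.
have [U [s [oU Ux0 ss ms]]] := (gamma_smooth m : jet_smooth setT m) x0 I.
have [f [sf f1]] := bump_function oU Ux0.
have [s' s'E] : exists s' : seq (cinf M * gamma E), forall x,
    \sum_(q <- s') q.1 x *: jet_of x q.2 = f x *: \sum_(p <- s) p.1 x *: jet_of x p.2.
  elim: s ss {ms} => [|p s IH] ss.
    by exists [::] => x; rewrite !big_nil scaler0.
  have [|s' s'E] := IH; first by move=> q qs; apply: ss; rewrite inE qs orbT.
  have sp : smooth_on U p.1 by apply: ss; rewrite inE eqxx.
  exists ((subelt (W := cinf_subspace M) (supp_smooth oU sf sp), p.2) :: s') => x.
  by rewrite !big_cons s'E scalerDr scalerA.
have fx0 : f x0 = 1 by exact: nbhs_singleton f1.
exists f, s'; split; first by rewrite fx0 oner_neq0.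
apply: gammaP => x; rewrite gscaleE gamma_sum.
rewrite (eq_bigr (fun q : cinf M * gamma E => q.1 x *: jet_of x q.2)) // s'E.
have [->|fx] := eqVneq (f x) 0; first by rewrite !scale0r.
by rewrite -ms //; exact: supp_in_neq0 sf fx.
Qed.

(** [lie_derivative] is a choice, so a section with the required pairings has to be produced. If f m
    is a sum of terms g du, the Leibniz rule forces f times the Lie derivative of m to be the sum of
    g d(d(u)) + a(g) du, with d applied to u inside the jet and a its symbol, minus a(f) m; such
    local solutions are glued. *)
Lemma lie_derivativeE d m r :
  jpairing (lie_derivative d m) r = dact d (jpairing m r) - jpairing m (gbracket d r).
Proof.
pose L r : gamma E := dact d (jpairing m r) - jpairing m (gbracket d r).
suff [m' m'P] : exists m', forall r, jpairing m' r = L r.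
  have := xgetPex (0 : gamma (jet_bundle E)) (ex_intro (fun m' => forall r, jpairing m' r = L r) m' m'P).
  exact.
have K0 x : forall r : gamma (gauge_bundle E), jet_pairing (0 : jet E x) (r x) = (0 : R) *: L r x.
  by move=> r'; rewrite jet0E jet_pairingE gauge_op0 scale0r.
have KD x (p q : R^o * jet E x) : (forall r, jet_pairing p.2 (r x) = p.1 *: L r x) ->
    (forall r, jet_pairing q.2 (r x) = q.1 *: L r x) ->
    forall r, jet_pairing (p + q).2 (r x) = (p + q).1 *: L r x.
  by move=> Kp Kq r'; rewrite jet_pairingD Kp Kq -scalerDl.
have KZ x (a : R) (p : R^o * jet E x) : (forall r, jet_pairing p.2 (r x) = p.1 *: L r x) ->
    forall r, jet_pairing (a *: p).2 (r x) = (a *: p).1 *: L r x.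
  by move=> Kp r'; rewrite jet_pairingZ Kp scalerA.
have [|m' m'P] := @glue R n M (jet_bundle E) (fun x => Defs.Subspace (K0 x) (@KD x) (@KZ x)); last first.
  by exists m' => r'; apply: gammaP => x; rewrite -[LHS]/(jet_pairing (m' x) (r' x)) (m'P x r') scale1r.
move=> x0; have [f [s [fx0 fs]]] := jet_bumped_sum m x0.
pose a := dsymbol d.
exists f, (\sum_(q <- s) (gscale q.1 (jet_sec (dact d q.2)) + gscale (vact a q.1) (jet_sec q.2))
           - gscale (vact a f) m); split=> // x r'.
set m' : gamma (jet_bundle E) := (_ - _); suff -> : jet_pairing (m' x) (r' x) = gscale f (L r') x by [].
rewrite -[LHS]/(jpairing m' r' x); congr (gamma_fun _ x).
have e1 : gscale f (dact d (jpairing m r')) + gscale (vact a f) (jpairing m r') =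
    \sum_(q <- s) (gscale q.1 (dact d (dact r' q.2)) + gscale (vact a q.1) (dact r' q.2)).
  rewrite -dact_leibniz -jpairing_gscale fs jpairing_sum dact_sum; apply: eq_bigr => q _.
  by rewrite jpairing_gscale jpairing_jet dact_leibniz.
have e2 : gscale f (jpairing m (gbracket d r')) =
    \sum_(q <- s) (gscale q.1 (dact d (dact r' q.2)) - gscale q.1 (dact r' (dact d q.2))).
  rewrite -jpairing_gscale fs jpairing_sum; apply: eq_bigr => q _.
  by rewrite jpairing_gscale jpairing_jet gbracketE gscaleDr gscaleNr.
rewrite /m' jpairingD jpairingN jpairing_gscale /L gscaleDr gscaleNr e2.
rewrite (_ : gscale f (dact d (jpairing m r')) = \sum_(q <- s) (gscale q.1 (dact d (dact r' q.2))
  + gscale (vact a q.1) (dact r' q.2)) - gscale (vact a f) (jpairing m r')); last first.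
  by rewrite -e1; zmod.
rewrite addrAC; congr (_ - _); rewrite jpairing_sum -sumrB; apply: eq_bigr => q _.
by rewrite jpairingD !jpairing_gscale !jpairing_jet; zmod.
Qed.

End jets.

(** * The omni-Lie bracket *)

Section omni_algebra.
Context {R : realType} {n : nat} {M : manifold R n} (E : bundle M).
Implicit Types (d r : gamma (gauge_bundle E)) (m : gamma (jet_bundle E)) (u : gamma E).
Implicit Types (X Y Z : gamma (omni E)) (f : cinf M).

Lemma bmap_at_comb x (a : R) (X Y : omni E x) :
  bmap_at (a *: X + Y) = a *: bmap_at X + bmap_at Y.
Proof.
transitivity ((gauge_symbol (a *: X.1 + Y.1), jet_proj (a *: X.2 + Y.2)) : calT E x).
  exact: erefl.
by rewrite gauge_symbol_comb jet_projD jet_projZ.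
Qed.

Lemma bmap_at0 x : bmap_at (0 : omni E x) = 0.
Proof.
have := bmap_at_comb (-1) (0 : omni E x) 0.
by rewrite scaler0 add0r scaleN1r addNr.
Qed.

Lemma bmap_atZ x (a : R) (X : omni E x) : bmap_at (a *: X) = a *: bmap_at X.
Proof. by rewrite -[a *: X]addr0 bmap_at_comb bmap_at0 addr0. Qed.

Lemma bmap_at_sum x (I : Type) (s : seq I) (F : I -> omni E x) :
  bmap_at (\sum_(i <- s) F i) = \sum_(i <- s) bmap_at (F i).
Proof.
elim/big_rec2: _ => [|i y1 y2 _ <-]; first exact: bmap_at0.
by rewrite -[F i]scale1r bmap_at_comb !scale1r.
Qed.

Lemma gfst_bracket X Y : gfst (omni_bracket X Y) = gbracket (gfst X) (gfst Y).
Proof. exact: gammaP. Qed.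

Lemma jpairing_bracket X Y q : jpairing (gsnd (omni_bracket X Y)) q =
  dact (gfst X) (jpairing (gsnd Y) q) - jpairing (gsnd Y) (gbracket (gfst X) q)
  - (dact (gfst Y) (jpairing (gsnd X) q) - jpairing (gsnd X) (gbracket (gfst Y) q))
  + dact q (jpairing (gsnd X) (gfst Y)).
Proof.
have -> : gsnd (omni_bracket X Y) = lie_derivative (gfst X) (gsnd Y) -
    lie_derivative (gfst Y) (gsnd X) + jet_sec (jpairing (gsnd X) (gfst Y)) by exact: gammaP.
by rewrite !jpairingD jpairingN !lie_derivativeE jpairing_jet.
Qed.

Lemma gauge_id_subproof x :
  gauge_subspace E x ((fun u : gamma E => u x), (0 : tangent x)).
Proof.
split=> [a u v|f u]; first exact: erefl.
by rewrite -[X in _ + X *: _]/(0 : R) scale0r addr0.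
Qed.

Lemma gauge_id_smooth :
  gauge_smooth setT (fun x => subelt (W := gauge_subspace E x) (gauge_id_subproof x)).
Proof. by split=> [u|]; [exact: gamma_smooth|exact: smooth_sec0]. Qed.

(** The identity operator, with zero symbol. It is central for the commutator and pairing with it is
    p, so the p-component of a bracket can be read off from the formula for pairings. *)
Definition gauge_id : gamma (gauge_bundle E) :=
  to_gamma (V := gauge_bundle E) gauge_id_smooth.

Lemma dact_id u : dact gauge_id u = u.
Proof. exact: gammaP. Qed.

Lemma jpairing_id m : jpairing m gauge_id = jproj m.
Proof. exact: gammaP. Qed.

Lemma jpairingE m r x : jpairing m r x = (r x : gauge E x) (jet_repr (m x)).
Proof. by []. Qed.

Lemma gbracketEx d r u x : ((gbracket d r) x : gauge E x) u =
  (d x : gauge E x) (dact r u) - (r x : gauge E x) (dact d u).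
Proof. by []. Qed.

Lemma jpairing_bracketN m d r : jpairing m (gbracket r d) = - jpairing m (gbracket d r).
Proof. by apply: gammaP => x; rewrite gammaN !jpairingE !gbracketEx opprB. Qed.

Lemma jpairing_bracket_id m d : jpairing m (gbracket d gauge_id) = 0.
Proof.
apply: gammaP => x; rewrite jpairingE gbracketEx dact_id.
by rewrite -[X in _ - X]/((d x : gauge E x) (jet_repr (m x))) subrr.
Qed.

Lemma jproj_bracket X Y : jproj (gsnd (omni_bracket X Y)) =
  dact (gfst X) (jproj (gsnd Y)) - dact (gfst Y) (jproj (gsnd X))
  + jpairing (gsnd X) (gfst Y).
Proof.
rewrite -jpairing_id jpairing_bracket !jpairing_bracket_id !jpairing_id dact_id.
by rewrite !subr0.
Qed.

Lemma vact_bracket d r f : vact (dsymbol (gbracket d r)) f =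
  vact (dsymbol d) (vact (dsymbol r) f) - vact (dsymbol r) (vact (dsymbol d) f).
Proof. exact: cinfP. Qed.

Lemma vactP (v w : gamma (tangent_bundle M)) : (forall f, vact v f = vact w f) -> v = w.
Proof.
move=> vw; apply: gammaP => x; apply: val_inj; apply/funext => f.
by move: (vw f) => /(congr1 (fun g : cinf M => g x)).
Qed.

Lemma calTP (s t : gamma (calT E)) : gfst s = gfst t -> gsnd s = gsnd t -> s = t.
Proof.
move=> s1 s2; apply: gammaP => x.
have e1 : (s x).1 = (t x).1 := congr1 (fun g : gamma (tangent_bundle M) => g x) s1.
have e2 : (s x).2 = (t x).2 := congr1 (fun g : gamma E => g x) s2.
by case: (s x) (t x) e1 e2 => [a b] [a' b'] /= -> ->.
Qed.

Lemma gfst_bmap X : gfst (bmap X) = dsymbol (gfst X).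
Proof. exact: gammaP. Qed.

Lemma gsnd_bmap X : gsnd (bmap X) = jproj (gsnd X).
Proof. exact: gammaP. Qed.

Lemma omni_pairing2 X Y :
  2%:R *: omni_pairing X Y = jpairing (gsnd Y) (gfst X) + jpairing (gsnd X) (gfst Y).
Proof. by rewrite /omni_pairing scalerA divff ?scale1r ?pnatr_eq0. Qed.

End omni_algebra.

(** * The falling operator and its dependence on bY *)

Section falling.
Context {R : realType} {n : nat} {M : manifold R n} {k : nat} (E : vector_bundle M k).
Implicit Types (X Y Z : gamma (omni E)).

(** With zero symbol the operator is linear over smooth functions, so expanding u in a dual frame
    expresses f(x) d(u) through the coordinates of u(x). *)
Lemma gauge_symbol0_local x (d : gauge E x) (u v : gamma E) :
  gauge_symbol d = 0 -> u x = v x -> d u = d v.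
Proof.
move=> d0; have [e [l [f [fx0 lP le]]]] := vector_bundle_dual E x.
have dE (w : gamma E) : f x *: d w = \sum_b l b x (w x) *: d (e b).
  pose c b : cinf M := subelt (W := cinf_subspace M) ((lP b).2 w).
  have gs g s : d (gscale g s) = g x *: d s.
    by rewrite gauge_leibniz d0 -[X in _ + X *: _]/(0 : R) scale0r addr0.
  have wE : gscale f w = \sum_b gscale (c b) (e b).
    by apply: gammaP => y; rewrite gamma_sum gscaleE -le.
  rewrite -gs wE.
  have dS (I : Type) (s : seq I) (F : I -> gamma E) :
      d (\sum_(i <- s) F i) = \sum_(i <- s) d (F i).
    by elim/big_rec2: _ => [|i y1 y2 _ <-]; [exact: gauge_op0|exact: gauge_opD].
  by rewrite dS; apply: eq_bigr => b _; rewrite gs.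
by move=> uv; apply: (scalerI fx0); rewrite !dE uv.
Qed.

(** At x, r - r' has zero symbol and so takes the same value on p(m) and on a representative of the
    jet m(x), which agree at x. This is the part of p{X, Y} whose dependence on bY alone is not
    visible from the formula. *)
Lemma jpairing_symbol (m : gamma (jet_bundle E)) (r r' : gamma (gauge_bundle E)) :
  dsymbol r = dsymbol r' ->
  jpairing m r - dact r (jproj m) = jpairing m r' - dact r' (jproj m).
Proof.
move=> rr; apply: gammaP => x; pose d : gauge E x := r x - r' x.
have dE u : d u = (r x : gauge E x) u - (r' x : gauge E x) u by [].
have d0 : gauge_symbol d = 0.
  have rrx : gauge_symbol (r x) = gauge_symbol (r' x) :=
    congr1 (fun g : gamma (tangent_bundle M) => g x) rr.
  rewrite /d -[r x]scale1r -scaleN1r [X in gauge_symbol X]addrC gauge_symbol_comb.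
  by rewrite scale1r rrx scaleN1r addNr.
have := @gauge_symbol0_local x d (jet_repr (m x)) (jproj m) d0 erefl.
rewrite !dE => H; rewrite !gammaD !gammaN !jpairingE.
rewrite -[dact r _ x]/((r x : gauge E x) (jproj m)).
rewrite -[dact r' _ x]/((r' x : gauge E x) (jproj m)).
by apply: (zmod_transfer H); zmod.
Qed.

Lemma bmap_bracketr X Y Y' : bmap Y = bmap Y' ->
  bmap (omni_bracket X Y) = bmap (omni_bracket X Y').
Proof.
move=> YY.
have Y1 : dsymbol (gfst Y) = dsymbol (gfst Y') by rewrite -!gfst_bmap YY.
have Y2 : jproj (gsnd Y) = jproj (gsnd Y') by rewrite -!gsnd_bmap YY.
apply: calTP.
  by rewrite !gfst_bmap !gfst_bracket; apply: vactP => f; rewrite !vact_bracket Y1.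
rewrite !gsnd_bmap !jproj_bracket Y2.
rewrite -!addrA; congr (_ + _); rewrite addrC [RHS]addrC.
exact: jpairing_symbol.
Qed.

Lemma fallingE X Y : falling X (bmap Y) = bmap (omni_bracket X Y).
Proof.
apply: bmap_bracketr.
exact: (xgetPex 0 (ex_intro (fun Y' => bmap Y' = bmap Y) Y erefl)).
Qed.

Lemma bmap_bracket_gscale X (f : cinf M) Y : bmap (omni_bracket X (gscale f Y)) =
  gscale f (bmap (omni_bracket X Y)) + gscale (vact (dsymbol (gfst X)) f) (bmap Y).
Proof.
apply: calTP.
  rewrite gfst_bmap gfst_bracket; apply: vactP => g; rewrite vact_bracket.
  have -> : dsymbol (gfst (gscale f Y)) = gscale f (dsymbol (gfst Y)).
    by apply: gammaP => x; exact: gauge_symbolZ.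
  apply: cinfP => x.
  set v := dsymbol (gfst X); set w := dsymbol (gfst Y).
  have vE h : vact v h x = (v x : tangent x) h by [].
  transitivity ((v x : tangent x) (cmul f (vact w g)) - f x * (w x : tangent x) (vact v g)).
    congr (_ - _); rewrite -vE; congr (cinf_fun (vact v _) x); exact: cinfP.
  rewrite tangent_leibniz.
  rewrite -[RHS]/(f x * ((v x : tangent x) (vact w g) - (w x : tangent x) (vact v g))
     + (v x : tangent x) f * (w x : tangent x) g).
  rewrite -[vact w g x]/((w x : tangent x) g).
  by ring.
rewrite gsnd_bmap jproj_bracket.
have -> : jproj (gsnd (gscale f Y)) = gscale f (jproj (gsnd Y)).
  by apply: gammaP => x; exact: jet_projZ.
have -> : dact (gfst (gscale f Y)) (jproj (gsnd X)) = gscale f (dact (gfst Y) (jproj (gsnd X))).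
  by apply: gammaP => x; exact: gauge_evalZ.
have -> : jpairing (gsnd X) (gfst (gscale f Y)) = gscale f (jpairing (gsnd X) (gfst Y)).
  by apply: gammaP => x; exact: gauge_evalZ.
rewrite dact_leibniz.
have -> : gsnd (gscale f (bmap (omni_bracket X Y)) + gscale (vact (dsymbol (gfst X)) f) (bmap Y)) =
   gscale f (gsnd (bmap (omni_bracket X Y))) + gscale (vact (dsymbol (gfst X)) f) (gsnd (bmap Y)).
  by exact: gammaP.
rewrite !gsnd_bmap jproj_bracket !gscaleDr gscaleNr; zmod.
Qed.

End falling.

(** * Lifting sections of A to L *)

Section lifting.
Context {R : realType} {n : nat} {M : manifold R n} {k : nat} (E : vector_bundle M k).
Context {r m : nat} (A : subbundle (calT E) r) (L : subbundle (omni E) m).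
Hypothesis bL : forall x, [set bmap_at X | X in (L x : set (omni E x))] = (A x : set (calT E x)).

Lemma bmap_at_onto x t : A x t -> exists2 X, L x X & bmap_at X = t.
Proof. by move=> At; have : (A x : set (calT E x)) t by []; rewrite -bL => -[X]; exists X. Qed.

Lemma bmap_at_in x X : L x X -> A x (bmap_at X).
Proof. by move=> LX; suff : (A x : set (calT E x)) (bmap_at X) by []; rewrite -bL; exists X. Qed.

(** Sections [Y0 i] of [L] are chosen to lift the frame of [A] at the single point [x0]. The matrix
    B of coordinates of their images is invertible there, and its adjugate solves for a lift of a up
    to the factor f det(B). *)
Lemma sgamma_lift (a : sgamma A) : exists Y : sgamma L, bmap Y = a.
Proof.
have K0 x : L x 0 /\ bmap_at (0 : omni E x) = (0 : R) *: a x.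
  by split; [exact: subspace0|rewrite bmap_at0 scale0r].
have KD x (p q : R^o * omni E x) : (L x p.2 /\ bmap_at p.2 = p.1 *: a x) ->
    (L x q.2 /\ bmap_at q.2 = q.1 *: a x) ->
    L x (p + q).2 /\ bmap_at (p + q).2 = (p + q).1 *: a x.
  move=> [Lp bp] [Lq bq]; split; first exact: subspaceD.
  have -> : (p + q).2 = 1 *: p.2 + q.2 by rewrite scale1r.
  by rewrite bmap_at_comb bp bq scale1r -scalerDl.
have KZ x (c : R) (p : R^o * omni E x) : (L x p.2 /\ bmap_at p.2 = p.1 *: a x) ->
    L x (c *: p).2 /\ bmap_at (c *: p).2 = (c *: p).1 *: a x.
  move=> [Lp bp]; split; first exact: subspaceZ.
  by rewrite bmap_atZ bp scalerA.
have [|Y YP] := @glue R n M (omni E) (fun x => Defs.Subspace (K0 x) (@KD x) (@KZ x)); last first.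
  exists (to_sgamma (fun x => (YP x).1)); apply: gammaP => x.
  by rewrite -[LHS]/(bmap_at (Y x)) (YP x).2 scale1r.
move=> x0; have [e [l [f [fx0 lP lspan ldual]]]] := dual_frame A x0.
have /choice[Y0 Y0P] : forall i, exists Y : sgamma L, bmap_at ((Y : gamma (omni E)) x0) = (e i : gamma (calT E)) x0.
  move=> i; have /bmap_at_onto[t Lt <-] := sgamma_in (e i) x0.
  by have [Y <-] := sgamma_through Lt; exists Y.
pose b i : gamma (calT E) := bmap (Y0 i).
pose B (x : M) := \matrix_(i, j) l j x (b i x).
have sB i j : smooth_on setT (fun x => B x i j : R^o).
  rewrite (_ : (fun _ => _) = fun x => l j x (b i x)); first by case: (lP j) => -[_ ls] _; exact: ls.
  by apply/funext => x; rewrite mxE.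
pose la j : cinf M := subelt (W := cinf_subspace M) ((lP j).1.2 a).
pose adjB i j : cinf M := subelt (W := cinf_subspace M) (smooth_on_adj sB i j).
pose detB : cinf M := subelt (W := cinf_subspace M) (smooth_on_det sB).
pose Y : sgamma L := \sum_i \sum_j sgscale (cmul (la j) (adjB j i)) (Y0 i).
have YE x : (Y : gamma (omni E)) x = \sum_i (\sum_j la j x * adjB j i x) *: (Y0 i : gamma (omni E)) x.
  rewrite /Y sgamma_sum gamma_sum; apply: eq_bigr => i _.
  by rewrite sgamma_sum gamma_sum scaler_suml.
have bA i x : A x (b i x) by apply: bmap_at_in; exact: sgamma_in.
exists (cmul f detB), (gscale f Y); split.
  rewrite -[cmul f detB x0]/(f x0 * \det (B x0)) mulf_neq0//.
  have -> : B x0 = (f x0)%:M.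
    by apply/matrixP => i j; rewrite !mxE -[b i x0]/(bmap_at _) Y0P ldual eq_sym.
  by rewrite det_scalar expf_neq0.
move=> x; split; first by apply: subspaceZ; exact: sgamma_in.
rewrite -[(cmul f detB x, _).1]/(f x * \det (B x)) -[(_, gscale f Y x).2]/(f x *: (Y : gamma (omni E)) x).
rewrite bmap_atZ YE bmap_at_sum mulrC -scalerA lspan; last exact: sgamma_in.
rewrite !scaler_sumr.
transitivity (\sum_i \sum_h ((\sum_j la j x * adjB j i x) * B x i h) *: (e h : gamma (calT E)) x).
  apply: eq_bigr => i _; rewrite bmap_atZ scalerA mulrC -scalerA.
  rewrite -[bmap_at _]/(b i x) lspan // scaler_sumr; apply: eq_bigr => h _.
  by rewrite scalerA mxE.
rewrite exchange_big; apply: eq_bigr => h _ /=.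
rewrite -scaler_suml scalerA; congr (_ *: _).
under eq_bigr do rewrite mulr_suml.
rewrite exchange_big /=.
transitivity (\sum_j la j x * (\adj (B x) *m B x) j h).
  apply: eq_bigr => j _; rewrite mxE mulr_sumr; apply: eq_bigr => i _.
  by rewrite mulrA.
rewrite mul_adj_mx (bigD1 h)//= mxE eqxx mulr1n big1 ?addr0 1?mulrC// => j jh.
by rewrite mxE (negbTE jh) mulr0n mulr0.
Qed.

End lifting.

(** * Derivations of projective Lie algebroids *)

Lemma scaler_injl_neq0 (R : fieldType) (V : lmodType R) (v : V) :
  v != 0 -> injective (fun a : R => a *: v).
Proof.
move=> v0 a b /eqP; rewrite -subr_eq0 -scalerBl scaler_eq0 (negbTE v0) orbF subr_eq0.
by move/eqP.
Qed.

Section algebroid.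
Context {R : realType} {n : nat} {M : manifold R n} (E : bundle M).
Context {r : nat} (A : projective_algebroid E r).
Implicit Types (a b c : sgamma A) (f : cinf M).

Lemma pa_bracketDr a b c : pa_bracket a (b + c) = pa_bracket a b + pa_bracket a c.
Proof. by rewrite -[b in LHS]scale1r pa_bracket_linear scale1r. Qed.

Lemma sgscaleDr (V : bundle M) m (W : subbundle V m) f (s t : sgamma W) :
  sgscale f (s + t) = sgscale f s + sgscale f t.
Proof. by apply: sgammaP; exact: gscaleDr. Qed.

Lemma DerP (D : Der A) : is_der D.
Proof. by have /subspace_predP := sval_ofP D. Qed.

Lemma der_add (D : Der A) a b : D (a + b) = D a + D b.
Proof. by have [DL _ _] := DerP D; rewrite -[a in LHS]scale1r DL scale1r. Qed.

(** Expanding D[a, f b] by the Leibniz rule first and by the derivation rule first gives two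
    multiples of b that must agree; a b with b(x) nonzero isolates the coefficients. *)
Lemma der_anchor (D : Der A) (v : gamma (tangent_bundle M)) : (0 < r)%N ->
  (forall f a, D (sgscale f a) = sgscale f (D a) + sgscale (vact v f) a) ->
  forall f a, vact (gfst (D a)) f = vact v (vact (gfst a) f) - vact (gfst a) (vact v f).
Proof.
move=> r0 Dv f a; apply: cinfP => x.
have [b bx] := sgamma_nonzero A r0 x; apply: (@scaler_injl_neq0 _ _ _ bx).
set g := vact (gfst (D a)) f; set h := vact v (vact (gfst a) f).
set h' := vact (gfst a) (vact v f).
have [_ _ Dbr] := DerP D.
have := Dbr a (sgscale f b).
rewrite Dv pa_bracketDr !pa_bracket_leibniz der_add !Dv Dbr sgscaleDr -/g -/h -/h' => H.
have {}H : sgscale g b = sgscale h b - sgscale h' b by apply: (zmod_transfer (esym H)); zmod.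
have := congr1 (fun s : sgamma A => (s : gamma (calT E)) x) H.
by rewrite -[LHS]/(g x *: _) -[X in _ = X -> _]/(h x *: (b : gamma (calT E)) x - h' x *: (b : gamma (calT E)) x) -scalerBl.
Qed.

End algebroid.

Section realization.
Context {R : realType} {n : nat} {M : manifold R n} {k : nat} (E : vector_bundle M k).

Lemma omni_functionals_realize m (l : 'I_m -> forall x, calT E x -> R) (w : 'I_m -> gamma E) :
  (forall i, omni_functional (E := E) (l i)) -> exists Z : gamma (omni E), forall x,
  [/\ gauge_symbol (Z x).1 = 0, jet_proj (Z x).2 = 0 &
      forall (t : calT E x) (u : gamma E) (r : gauge E x), u x = t.2 -> gauge_symbol r = t.1 ->
        gauge_op (Z x).1 u + jet_pairing (Z x).2 r = \sum_i l i x t *: w i x].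
Proof.
move=> lP; elim: (index_enum _) => [|i s [Z ZP]].
  exists 0 => x; split=> [||t u r _ _]; first exact: erefl.
    by rewrite -[X in jet_proj X]/(0 : jet E x) jet0E jet_projE.
  by rewrite big_nil -[X in jet_pairing X]/(0 : jet E x) jet0E jet_pairingE gauge_op0 addr0.
have [X XP] := (lP i).2 (w i).
exists (gscale (cinf_cst 1) X + Z) => x.
have [s1 p1 e1] := XP x; have [s2 p2 e2] := ZP x.
have c1 : cinf_cst (M := M) 1 x = 1 by [].
split=> [||t u r ut rt].
- by rewrite omni_fst_comb gauge_symbol_comb s1 s2 scaler0 addr0.
- by rewrite omni_snd_comb jet_projD jet_projZ p1 p2 scaler0 addr0.
rewrite omni_snd_comb jet_pairingD jet_pairingZ omni_fst_comb gauge_eval_comb c1 !scale1r.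
by rewrite addrACA (e1 _ _ _ ut rt) (e2 _ _ _ ut rt) big_cons.
Qed.

(** The operator differentiates the dual coordinates along v. These reproduce u only up to the
    factor [f], so the symbol is f v. *)
Lemma local_connection (v : gamma (tangent_bundle M)) x0 :
  exists (d : gamma (gauge_bundle E)) (f : cinf M), f x0 != 0 /\ dsymbol d = gscale f v.
Proof.
have [e [l [f [fx0 lP le]]]] := vector_bundle_dual E x0.
pose lu b (u : gamma E) : cinf M := subelt (W := cinf_subspace M) ((lP b).2 u).
have luL b (a : R) u u' : lu b (a *: u + u') = a *: lu b u + lu b u'.
  by apply: cinfP => x; exact: (lP b).1.
have luZ b g u : lu b (gscale g u) = cmul g (lu b u).
  apply: cinfP => x; have [lL _] := lP b.
  have l0 : l b x 0 = 0 by have := lL x (-1) 0 0; rewrite scaler0 add0r mulN1r addNr.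
  by rewrite -[LHS]/(l b x (g x *: u x)) -[_ *: _]addr0 lL l0 addr0.
pose op (x : M) (u : gamma E) : E x := \sum_b (v x : tangent x) (lu b u) *: e b x.
have gop x : gauge_subspace E x (op x, f x *: v x).
  split=> [a u u'|g u].
    rewrite -[LHS]/(op x (a *: u + u')) -[RHS]/(a *: op x u + op x u').
    rewrite scaler_sumr -big_split; apply: eq_bigr => b _ /=.
    by rewrite luL tangent_lin scalerDl scalerA.
  rewrite -[LHS]/(op x (gscale g u)).
  rewrite -[RHS]/(g x *: op x u + (f x * (v x : tangent x) g) *: u x).
  rewrite mulrC -scalerA -le !scaler_sumr -big_split; apply: eq_bigr => b _ /=.
  by rewrite luZ tangent_leibniz scalerDl !scalerA [X in _ + X *: _]mulrC.
have sop : gauge_smooth setT (fun x => subelt (W := gauge_subspace E x) (gop x)).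
  split=> [u|]; last exact: (gamma_smooth (gscale f v)).
  rewrite (_ : (fun _ => _) = gamma_fun (\sum_b gscale (vact v (lu b u)) (e b))).
    exact: gamma_smooth.
  by apply: functional_extensionality_dep => x; rewrite gamma_sum.
exists (to_gamma (V := gauge_bundle E) sop), f; split=> //.
exact: gammaP.
Qed.

End realization.

Section der_realization.
Context {R : realType} {n : nat} {M : manifold R n} {k : nat} (E : vector_bundle M k).
Context {r : nat} (r_gt0 : (0 < r)%N) (A : projective_algebroid E r).

Lemma der_realization (D : Der A) : exists X : gamma (omni E),
  forall (a : sgamma A) Y, bmap Y = a -> bmap (omni_bracket X Y) = D a.
Proof.
have [_ [v Dv] _] := DerP D.
(* Requiring p(X) = 0 removes the term of p{X, Y} that differentiates p(X). What is left is linear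
   in X at x, and the TM-component is settled by the symbol through [der_anchor]. *)
pose P x (c : R) (X : omni E x) := [/\ gauge_symbol X.1 = c *: v x, jet_proj X.2 = 0 &
  forall (a : sgamma A) (q : gauge E x), gauge_symbol q = gfst a x ->
    gauge_op X.1 (gsnd a) + jet_pairing X.2 q = c *: gsnd (D a) x].
have P0 x : P x 0 0.
  split=> [||a q _]; first by rewrite scale0r.
    by rewrite -[X in jet_proj X]/(0 : jet E x) jet0E jet_projE.
  rewrite -[X in jet_pairing X]/(0 : jet E x) jet0E jet_pairingE gauge_op0 addr0.
  by rewrite scale0r.
have PD x (c c' a : R) (X Y : omni E x) : P x c X -> P x c' Y -> P x (a * c + c') (a *: X + Y).
  move=> [s1 p1 e1] [s2 p2 e2]; split=> [||b q bq].
  - rewrite -[(a *: X + Y).1]/(a *: X.1 + Y.1) gauge_symbol_comb s1 s2.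
    by rewrite scalerA scalerDl.
  - rewrite -[(a *: X + Y).2]/(a *: X.2 + Y.2) jet_projD jet_projZ p1 p2.
    by rewrite scaler0 addr0.
  rewrite -[(a *: X + Y).1]/(a *: X.1 + Y.1) -[(a *: X + Y).2]/(a *: X.2 + Y.2).
  rewrite gauge_eval_comb jet_pairingD jet_pairingZ addrACA -scalerDr.
  by rewrite (e1 b q bq) (e2 b q bq) scalerA scalerDl.
have KD x (p q : R^o * omni E x) : P x p.1 p.2 -> P x q.1 q.2 -> P x (p + q).1 (p + q).2.
  move=> Pp Pq; have -> : (p + q).1 = 1 * p.1 + q.1 by rewrite mul1r.
  have -> : (p + q).2 = 1 *: p.2 + q.2 by rewrite scale1r.
  exact: PD.
have KZ x (a : R) (p : R^o * omni E x) : P x p.1 p.2 -> P x (a *: p).1 (a *: p).2.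
  move=> Pp; have -> : (a *: p).1 = a * p.1 + 0 by rewrite addr0.
  have -> : (a *: p).2 = a *: p.2 + 0 by rewrite addr0.
  exact: PD.
pose K x := @Defs.Subspace R (R^o * omni E x)%type (fun p => P x p.1 p.2) (P0 x) (KD x) (KZ x).
have [|X XP] := @glue R n M (omni E) K; last first.
  exists X => a Y bY.
  have Xv : dsymbol (gfst X) = v.
    by apply: gammaP => x; have [/= s _ _] := XP x; rewrite -[LHS]/(gauge_symbol (X x).1) s scale1r.
  have X0 : jproj (gsnd X) = 0.
    by apply: gammaP => x; have [/= _ p _] := XP x; rewrite -[LHS]/(jet_proj (X x).2) p.
  have Y1 : dsymbol (gfst Y) = gfst a by rewrite -gfst_bmap bY.
  have Y2 : jproj (gsnd Y) = gsnd a by rewrite -gsnd_bmap bY.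
  apply: calTP.
    rewrite gfst_bmap gfst_bracket; apply: vactP => f.
    by rewrite vact_bracket Xv Y1 (der_anchor r_gt0 Dv).
  rewrite gsnd_bmap jproj_bracket X0 Y2 dact0 subr0.
  apply: gammaP => x; have [/= _ _ e] := XP x.
  have := e a (gfst Y x); rewrite scale1r; apply.
  exact: (congr1 (fun s : gamma (tangent_bundle M) => s x) Y1).
move=> x0.
have [d [f [fx0 df]]] := local_connection E v x0.
have [e [l [g [gx0 lP lspan _]]]] := dual_frame A x0.
(* Both terms have the same Leibniz defect along f v, so [H] is linear over smooth functions; its
   expansion in the dual frame is what [Z] in the kernel of b realizes. *)
pose H (a : sgamma A) : gamma E := gscale f (gsnd (D a)) - dact d (gsnd a).
have HZ h a : H (sgscale h a) = gscale h (H a).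
  rewrite /H Dv.
  have -> : gsnd (sgscale h (D a) + sgscale (vact v h) a : sgamma A) =
     gscale h (gsnd (D a)) + gscale (vact v h) (gsnd a) by exact: gammaP.
  have -> : gsnd (sgscale h a) = gscale h (gsnd a) by exact: gammaP.
  rewrite dact_leibniz df gscaleDr gscaleDr gscaleNr.
  have gC (p q : cinf M) (s : gamma E) : gscale p (gscale q s) = gscale (cmul p q) s.
    by apply: gammaP => x; rewrite !gscaleE scalerA.
  rewrite !gC (_ : vact (gscale f v) h = cmul f (vact v h)); last exact: cinfP.
  rewrite (_ : cmul h f = cmul f h); last by apply: cinfP => x; exact: mulrC.
  by zmod.
have HS (I : Type) (s : seq I) (F : I -> sgamma A) : H (\sum_(i <- s) F i) = \sum_(i <- s) H (F i).
  have HD (a b : sgamma A) : H (a + b) = H a + H b.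
    rewrite /H der_add.
    have -> : gsnd (D a + D b : sgamma A) = gsnd (D a) + gsnd (D b) by exact: gammaP.
    have -> : gsnd (a + b : sgamma A) = gsnd a + gsnd b by exact: gammaP.
    by rewrite gscaleDr dactD; zmod.
  have H0 : H 0 = 0 by apply: (addrI (H 0)); rewrite -HD !addr0.
  by elim/big_rec2: _ => [//|i y1 y2 _ <-]; exact: HD.
have [Z ZP] := omni_functionals_realize (fun i => H (e i)) lP.
pose d' : gamma (omni E) := gpair d (0 : gamma (jet_bundle E)).
pose X : gamma (omni E) := gscale g d' + Z.
have d'1 x : (d' x).1 = d x by [].
have d'2 x : (d' x).2 = jet_of x 0 by rewrite -jet0E.
exists (cmul g f), X; split.
  by rewrite -[cmul g f x0]/(g x0 * f x0) mulf_neq0.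
move=> x; have [s1 p1 e1] := ZP x.
have dx : gauge_symbol (d x) = f x *: v x := congr1 (fun s : gamma (tangent_bundle M) => s x) df.
change (P x (g x * f x) (X x)); split.
-  by rewrite omni_fst_comb gauge_symbol_comb d'1 s1 addr0 dx scalerA.
-  by rewrite omni_snd_comb jet_projD jet_projZ p1 addr0 d'2 jet_projE scaler0.
move=> a q aq.
rewrite omni_snd_comb jet_pairingD jet_pairingZ omni_fst_comb gauge_eval_comb.
rewrite d'1 d'2 jet_pairingE gauge_op0 scaler0 add0r.
rewrite -addrA (e1 ((a : gamma (calT E)) x)) //.
pose la i : cinf M := subelt (W := cinf_subspace M) ((lP i).1.2 a).
have : gscale g (H a) = \sum_i gscale (la i) (H (e i)).
  under eq_bigr do rewrite -HZ.
  rewrite -HS -HZ; congr H; apply: sgammaP; apply: gammaP => y.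
  rewrite sgamma_sum gamma_sum -[LHS]/(g y *: (a : gamma (calT E)) y) lspan //.
  exact: sgamma_in.
move=> /(congr1 (fun s : gamma E => s x)); rewrite gamma_sum => <-.
rewrite -[gscale g (H a) x]/(g x *: (f x *: gsnd (D a) x - gauge_op (d x) (gsnd a))).
rewrite -scalerA scalerBr.
by rewrite addrCA subrr addr0.
Qed.

End der_realization.

(** * Normalizers and cocycles *)

Section omni_identities.
Context {R : realType} {n : nat} {M : manifold R n} (E : bundle M).
Implicit Types (X Y Z : gamma (omni E)) (a : R).

Lemma vact_comb a (v w : gamma (tangent_bundle M)) f :
  vact (a *: v + w) f = a *: vact v f + vact w f.
Proof. exact: cinfP. Qed.

Lemma dsymbol_comb a (d d' : gamma (gauge_bundle E)) :
  dsymbol (a *: d + d') = a *: dsymbol d + dsymbol d'.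
Proof. by apply: gammaP => x; exact: gauge_symbol_comb. Qed.

Lemma dact_comb a (d d' : gamma (gauge_bundle E)) u :
  dact (a *: d + d') u = a *: dact d u + dact d' u.
Proof. by apply: gammaP => x; exact: gauge_eval_comb. Qed.

Lemma jpairing_combr m a (d d' : gamma (gauge_bundle E)) :
  jpairing m (a *: d + d') = a *: jpairing m d + jpairing m d'.
Proof. by apply: gammaP => x; exact: gauge_eval_comb. Qed.

Lemma jproj_comb a (m m' : gamma (jet_bundle E)) :
  jproj (a *: m + m') = a *: jproj m + jproj m'.
Proof. by rewrite -!jpairing_id jpairingD jpairingZ. Qed.

Lemma gfst_comb a X Y : gfst (a *: X + Y : gamma (omni E)) = a *: gfst X + gfst Y.
Proof. by apply: gammaP => x; exact: erefl. Qed.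

Lemma gsnd_comb a X Y : gsnd (a *: X + Y : gamma (omni E)) = a *: gsnd X + gsnd Y.
Proof. by apply: gammaP => x; exact: erefl. Qed.

Lemma omni_pairing_combl a X Y Z :
  omni_pairing (a *: X + Y) Z = a *: omni_pairing X Z + omni_pairing Y Z.
Proof.
rewrite /omni_pairing gfst_comb gsnd_comb jpairing_combr jpairingD jpairingZ.
by rewrite addrACA -scalerDr [LHS]scalerDr !scalerA mulrC.
Qed.

Lemma omni_pairingC X Y : omni_pairing X Y = omni_pairing Y X.
Proof. by rewrite /omni_pairing addrC. Qed.

Lemma omni_pairing_gscalel f X Y :
  omni_pairing (gscale f X) Y = gscale f (omni_pairing X Y).
Proof.
have e1 : gfst (gscale f X) = gscale f (gfst X) by apply: gammaP => x; exact: erefl.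
have e2 : gsnd (gscale f X) = gscale f (gsnd X) by apply: gammaP => x; exact: erefl.
have e3 : jpairing (gsnd Y) (gscale f (gfst X)) = gscale f (jpairing (gsnd Y) (gfst X)).
  by apply: gammaP => x; exact: gauge_evalZ.
rewrite /omni_pairing e1 e2 e3 jpairing_gscale -gscaleDr.
by apply: gammaP => x; rewrite gscaleE !gammaZ gscaleE !scalerA mulrC.
Qed.

Lemma bmap_bracket_combl a X Y Z : bmap (omni_bracket (a *: X + Y) Z) =
  a *: bmap (omni_bracket X Z) + bmap (omni_bracket Y Z).
Proof.
have fstC (s t : gamma (calT E)) : gfst (a *: s + t : gamma (calT E)) = a *: gfst s + gfst t.
  exact: gammaP.
have sndC (s t : gamma (calT E)) : gsnd (a *: s + t : gamma (calT E)) = a *: gsnd s + gsnd t.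
  exact: gammaP.
have vactD (v : gamma (tangent_bundle M)) f g : vact v (a *: f + g) = a *: vact v f + vact v g.
  by apply: cinfP => x; exact: tangent_lin.
apply: calTP.
  rewrite fstC !gfst_bmap !gfst_bracket; apply: vactP => f.
  rewrite vact_comb !vact_bracket gfst_comb dsymbol_comb !vact_comb vactD.
  by rewrite scalerBr; zmod.
rewrite sndC !gsnd_bmap !jproj_bracket gfst_comb gsnd_comb dact_comb jproj_comb.
rewrite dactD dactZ jpairingD jpairingZ !scalerDr scalerN.
by zmod.
Qed.

Lemma omni_pairing_bracket X Y Z : omni_pairing (omni_bracket X Y) Z =
  - (dact (gfst Y) (omni_pairing X Z) - dact (gfst Z) (omni_pairing X Y)
     - omni_pairing X (omni_bracket Y Z)).
Proof.
apply: (@scalerI _ _ 2%:R); first by rewrite pnatr_eq0.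
rewrite scalerN !scalerDr !scalerN -!dactZ !omni_pairing2 !jpairing_bracket !gfst_bracket !dactD.
rewrite (jpairing_bracketN _ (gfst X) (gfst Y)) (jpairing_bracketN _ (gfst X) (gfst Z)).
by zmod.
Qed.

(** The p-component of a combination of two facts: {X, {Y, Z}} - {Y, {X, Z}} = {{X, Y}, Z}, and the
    symmetric part {W, Z} + {Z, W} = 2 d(W, Z)_E taken at W = {X, Y}. *)
Lemma jproj_jacobiator X Y Z : jproj (gsnd (omni_bracket X (omni_bracket Y Z)))
    + jproj (gsnd (omni_bracket Z (omni_bracket X Y)))
    - jproj (gsnd (omni_bracket Y (omni_bracket X Z))) =
  2%:R *: omni_pairing (omni_bracket X Y) Z.
Proof.
rewrite omni_pairing2 !jproj_bracket !jpairing_bracket !gfst_bracket !gbracketE.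
rewrite !(dactD, dactN).
by zmod.
Qed.

Definition omni_jet (u : gamma E) : gamma (omni E) :=
  gpair (0 : gamma (gauge_bundle E)) (jet_sec u).

Lemma omni_pairing_jet u X : 2%:R *: omni_pairing (omni_jet u) X = dact (gfst X) u.
Proof.
rewrite omni_pairing2; have -> : gfst (omni_jet u) = 0 by exact: gammaP.
have -> : gsnd (omni_jet u) = jet_sec u by exact: gammaP.
rewrite jpairing_jet -[X in jpairing _ X](scale0r 0) -[X in jpairing _ X]addr0.
rewrite jpairing_combr scale0r add0r.
have -> : jpairing (gsnd X) 0 = 0 by exact: gammaP.
by rewrite add0r.
Qed.

Lemma bmap_bracket_jet u X : bmap (omni_bracket (omni_jet u) X) = 0.
Proof.
have e1 : gfst (omni_jet u) = 0 by exact: gammaP.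
have e2 : gsnd (omni_jet u) = jet_sec u by exact: gammaP.
have v0 f : vact (0 : gamma (tangent_bundle M)) f = 0 by exact: cinfP.
have s0 : dsymbol (0 : gamma (gauge_bundle E)) = 0 by exact: gammaP.
have v00 v : vact v (0 : cinf M) = 0.
  apply: cinfP => x; have := tangent_lin (v x) (-1) 0 0.
  by rewrite scaler0 add0r mulN1r addNr.
apply: calTP.
  rewrite gfst_bmap gfst_bracket; apply: vactP => f.
  rewrite vact_bracket e1 s0 !v0 v00 subr0.
  by have -> : gfst (0 : gamma (calT E)) = 0 by exact: gammaP.
rewrite gsnd_bmap jproj_bracket e1 e2 jpairing_jet.
have -> : jproj (jet_sec u) = u by apply: gammaP => x; exact: jet_projE.
have -> : dact 0 (jproj (gsnd X)) = 0 by exact: gammaP.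
have -> : gsnd (0 : gamma (calT E)) = 0 by exact: gammaP.
by zmod.
Qed.

End omni_identities.

Section dirac_pairing.
Context {R : realType} {n : nat} {M : manifold R n} (E : bundle M) (L : dirac E).

Lemma dirac_isotropic (Y Z : sgamma L) : omni_pairing Y Z = 0.
Proof.
apply: gammaP => x; rewrite omni_pairingE.
have : (L x : set (omni E x)) ((Y : gamma (omni E)) x) by exact: sgamma_in.
by rewrite -dirac_lagrangian; apply; exact: sgamma_in.
Qed.

(** Every vector of a fibre of [L] is the value of a global section, so global test sections
    suffice. *)
Lemma dirac_maximal (X : gamma (omni E)) :
  (forall Z : sgamma L, omni_pairing X Z = 0) -> sgamma_subspace L X.
Proof.
move=> XL x; suff : (L x : set (omni E x)) (X x) by [].
rewrite -dirac_lagrangian => s Ls; have [Z <-] := sgamma_through Ls.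
by rewrite -omni_pairingE XL.
Qed.

Lemma d1_omega (X : gamma (omni E)) (Y Z : sgamma L) :
  d1 (omega (L := L) X) Y Z = - omni_pairing (omni_bracket X Y) Z.
Proof. by rewrite omni_pairing_bracket opprK. Qed.

Lemma normalizerP (X : gamma (omni E)) :
  normalizer L X <-> forall Y Z : sgamma L, d1 (omega (L := L) X) Y Z = 0.
Proof.
split=> [NX Y Z|dX Y LY].
  have LXY := NX Y (sgamma_in Y).
  by rewrite d1_omega (dirac_isotropic (to_sgamma LXY) Z) oppr0.
apply: dirac_maximal => Z.
by have /eqP := dX (to_sgamma LY) Z; rewrite d1_omega oppr_eq0 => /eqP.
Qed.

Lemma omega_cochain (X : gamma (omni E)) : is_cochain1 (omega (L := L) X).
Proof.
have oD (Y Z : sgamma L) : omega X (Y + Z) = omega X Y + omega X Z.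
  rewrite /omega !(omni_pairingC X).
  have -> : ((Y + Z : sgamma L) : gamma (omni E)) = 1 *: (Y : gamma (omni E)) + (Z : gamma (omni E)).
    by rewrite scale1r.
  by rewrite omni_pairing_combl scale1r.
split=> [|f Y]; first exact: oD.
by rewrite /omega !(omni_pairingC X) omni_pairing_gscalel.
Qed.

Lemma normalizer_cocycle (X : gamma (omni E)) : normalizer L X -> is_cocycle1 (omega (L := L) X).
Proof. by move=> /normalizerP dX; split; [exact: omega_cochain|]. Qed.

Definition omega_Z1 (X : gamma (omni E)) (NX : normalizer L X) : Z1 L :=
  subelt (W := Z1_subspace L) (normalizer_cocycle NX).

End dirac_pairing.

(** * Inner derivations and exact cocycles *)

Section comparison.
Context {R : realType} {n : nat} {M : manifold R n} {k : nat} (E : vector_bundle M k).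
Context {r : nat} (r_gt0 : (0 < r)%N) (A : projective_algebroid E r).
Context (L : dirac E) (L_lifts_A : is_lifted_dirac A L).
Implicit Types (X : gamma (omni E)) (a b : sgamma A) (Y Z : sgamma L).

Let lift a : exists Y : sgamma L, bmap Y = a.
Proof. by case: L_lifts_A => _ bL _; exact: sgamma_lift. Qed.

Let bmap_in Y x : A x (bmap Y x).
Proof. by case: L_lifts_A => _ bL _; apply: (bmap_at_in bL); exact: sgamma_in. Qed.

Let descend Y : sgamma A := to_sgamma (bmap_in Y).

Let bmap_pa Y Z a b : bmap Y = a -> bmap Z = b ->
  bmap (omni_bracket Y Z) = pa_bracket a b.
Proof. by case: L_lifts_A => _ _ H; exact: H. Qed.

(** Trades the preimage chosen inside [falling] for all preimages under b; the existence of one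
    comes from lifting to [L]. *)
Lemma falling_bmap X (D : sgamma A -> sgamma A) :
  (forall a, falling X a = D a) <->
  (forall a (Y : gamma (omni E)), bmap Y = a -> bmap (omni_bracket X Y) = D a).
Proof.
split=> [FD a Y bY|bD a]; first by rewrite -FD -bY fallingE.
by have [Y bY] := lift a; rewrite -bY fallingE; exact: bD.
Qed.

Lemma der_normalizer X (D : Der A) :
  (forall a (Y : gamma (omni E)), bmap Y = a -> bmap (omni_bracket X Y) = D a) ->
  normalizer L X.
Proof.
move=> bD; apply/normalizerP => Y Z; rewrite d1_omega.
apply/eqP; rewrite oppr_eq0; apply/eqP.
apply: (@scalerI _ _ 2%:R); first by rewrite pnatr_eq0.
rewrite scaler0 -jproj_jacobiator.
pose a := descend Y; pose b := descend Z.
(* {X, Y} and {X, Z} are not yet known to lie in [L], so the bracket of [A] does not apply to them;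
   inside b they may be replaced by sections of [L] with the same image. *)
have [Y' bY'] := lift (D a); have [Z' bZ'] := lift (D b).
have e1 : bmap (omni_bracket X (omni_bracket Y Z)) = D (pa_bracket a b).
  by apply: bD; exact: bmap_pa.
have e2 : bmap (omni_bracket Z (omni_bracket X Y)) = pa_bracket b (D a).
  rewrite -(bmap_pa (erefl : bmap Z = b) bY'); apply: bmap_bracketr.
  by rewrite bY'; exact: bD.
have e3 : bmap (omni_bracket Y (omni_bracket X Z)) = pa_bracket a (D b).
  rewrite -(bmap_pa (erefl : bmap Y = a) bZ'); apply: bmap_bracketr.
  by rewrite bZ'; exact: bD.
rewrite -!gsnd_bmap e1 e2 e3.
have [_ _ Dbr] := DerP D; rewrite Dbr [pa_bracket b _]pa_bracket_skew.
set s := pa_bracket (D a) b; set t := pa_bracket a (D b).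
have -> : gsnd (s + t : sgamma A) = gsnd s + gsnd t by exact: gammaP.
have -> : gsnd (- s : sgamma A) = - gsnd s by exact: gammaP.
by zmod.
Qed.

(* [X - 2 de] lies in [L], and [X] acts on [A] as bracketing with [b (X - 2 de)]. *)
Lemma exact_inner X (D : sgamma A -> sgamma A) e :
  (forall a (Y : gamma (omni E)), bmap Y = a -> bmap (omni_bracket X Y) = D a) ->
  (forall Y, omni_pairing X Y = dact (gfst Y) e) ->
  exists a, forall b, D b = pa_bracket a b.
Proof.
move=> bD oX; pose W : gamma (omni E) := - 2%:R *: omni_jet e + X.
have LW : sgamma_subspace L W.
  apply: dirac_maximal => Z.
  by rewrite /W omni_pairing_combl scaleNr omni_pairing_jet oX addNr.
exists (descend (to_sgamma LW)) => b; apply: sgammaP.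
have [Y bY] := lift b.
rewrite -(bD b Y bY) -(@bmap_pa (to_sgamma LW) Y (descend (to_sgamma LW)) b erefl bY).
rewrite -[sgamma_val (to_sgamma LW)]/W /W bmap_bracket_combl bmap_bracket_jet.
by rewrite scaler0 add0r.
Qed.

(** Subtracting a lift l of a keeps the cocycle, as [L] is isotropic, and leaves W with b{W, Y} = 0
    for Y in [L]. The Leibniz rule on a nonvanishing section of [A] kills the symbol of W, whence
    the pairing of W with the jet part of Y is W applied to p(Y), and p{W, Y} = 0 turns twice the
    pairing of W and Y into the action of Y on p(W). *)
Lemma inner_exact X a :
  (forall b (Y : gamma (omni E)), bmap Y = b -> bmap (omni_bracket X Y) = pa_bracket a b) ->
  exists e, forall Y, omni_pairing X Y = dact (gfst Y) e.
Proof.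
move=> bX; have [l bl] := lift a.
pose W : gamma (omni E) := - 1 *: (l : gamma (omni E)) + X.
have W0 Y : bmap (omni_bracket W Y) = 0.
  rewrite /W bmap_bracket_combl (@bmap_pa l Y a (descend Y)) // (bX (descend Y)) //.
  by rewrite scaleN1r addNr.
have sW : dsymbol (gfst W) = 0.
  apply: vactP => f; apply: cinfP => x.
  have [b bx] := sgamma_nonzero A r_gt0 x; have [Y bY] := lift b.
  have := bmap_bracket_gscale W f Y; rewrite (W0 (sgscale f Y)) W0 bY => H.
  have {}H : gscale (vact (dsymbol (gfst W)) f) b = 0.
    rewrite [RHS]H (_ : gscale f 0 = 0) ?add0r //.
    by apply: gammaP => y; rewrite gscaleE scaler0.
  move: (congr1 (fun s : gamma (calT E) => s x) H); rewrite gscaleE.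
  by move/eqP; rewrite scaler_eq0 (negbTE bx) orbF => /eqP.
exists (2^-1 *: jproj (gsnd W)) => Y.
have -> : omni_pairing X Y = omni_pairing W Y.
  by rewrite /W omni_pairing_combl dirac_isotropic scaler0 add0r.
apply: (@scalerI _ _ 2%:R); first by rewrite pnatr_eq0.
rewrite omni_pairing2 -dactZ scalerA divff ?pnatr_eq0 // scale1r.
have H : dact (gfst W) (jproj (gsnd Y)) - dact (gfst Y) (jproj (gsnd W))
    + jpairing (gsnd W) (gfst Y) = 0.
  by rewrite -jproj_bracket -gsnd_bmap W0; exact: gammaP.
have s0 : dsymbol (0 : gamma (gauge_bundle E)) = 0 by exact: gammaP.
have J : jpairing (gsnd Y) (gfst W) - dact (gfst W) (jproj (gsnd Y)) = 0.
  rewrite (@jpairing_symbol _ _ _ _ _ _ _ 0) ?sW ?s0 //.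
  have -> : jpairing (gsnd Y) 0 = 0 by exact: gammaP.
  by have -> : dact 0 (jproj (gsnd Y)) = 0; [exact: gammaP|rewrite subr0].
apply: (zmod_transfer (a := jpairing (gsnd Y) (gfst W) - dact (gfst W) (jproj (gsnd Y)) +
  (dact (gfst W) (jproj (gsnd Y)) - dact (gfst Y) (jproj (gsnd W))
    + jpairing (gsnd W) (gfst Y))) (b := 0)).
  by rewrite J H addr0.
by zmod.
Qed.

End comparison.

(** * The correspondence between derivations and cocycles *)

Section realizes.
Context {R : realType} {n : nat} {M : manifold R n} {k : nat} (E : vector_bundle M k).
Context {r : nat} (r_gt0 : (0 < r)%N) (A : projective_algebroid E r).
Context (L : dirac E) (L_lifts_A : is_lifted_dirac A L).

(** A relation rather than a map, since X is not determined by D. It is linear and matches inner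
    derivations with coboundaries, so the two directions of [realizes_class] say that the induced
    map is well defined and injective. *)
Definition realizes (D : Der A) (w : Z1 L) := exists X : gamma (omni E),
  (forall a (Y : gamma (omni E)), bmap Y = sgamma_val a -> bmap (omni_bracket X Y) = D a) /\
  (forall Y, w Y = omega X Y).

Lemma subspace_comb (V : lmodType R) (W : Defs.subspace V) (t : R) (u v : subspace_type W) :
  sval_of (t *: u + v) = t *: sval_of u + sval_of v.
Proof. exact: erefl. Qed.

Lemma sgamma_comb (V : bundle M) m (W : subbundle V m) (t : R) (s s' : sgamma W) :
  sgamma_val (t *: s + s') = t *: sgamma_val s + sgamma_val s'.
Proof. exact: erefl. Qed.

Lemma Der_comb (t : R) (D D' : Der A) a : (t *: D + D' : Der A) a = t *: D a + D' a.
Proof. by rewrite /Der_fun (@subspace_comb _ (Der_subspace A)). Qed.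

Lemma Z1_comb (t : R) (w w' : Z1 L) Y : (t *: w + w' : Z1 L) Y = t *: w Y + w' Y.
Proof. by rewrite /Z1_fun (@subspace_comb _ (Z1_subspace L)). Qed.

Lemma realizes_comb (t : R) D D' w w' : realizes D w -> realizes D' w' ->
  realizes (t *: D + D') (t *: w + w').
Proof.
move=> [X [bX oX]] [X' [bX' oX']]; exists (t *: X + X'); split=> [a Y bY|Y].
  by rewrite bmap_bracket_combl (bX a Y bY) (bX' a Y bY) Der_comb sgamma_comb.
have e : omni_pairing X Y = w Y := esym (oX Y).
have e' : omni_pairing X' Y = w' Y := esym (oX' Y).
by rewrite /omega omni_pairing_combl e e' Z1_comb.
Qed.

Lemma realizes_exact D w : realizes D w -> is_inn D <-> is_coboundary1 w.
Proof.
move=> [X [bX oX]]; split=> [[a Da]|[e we]].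
  have [|e oe] := @inner_exact _ _ _ _ _ _ r_gt0 A L L_lifts_A X a.
    by move=> b Y bY; rewrite (bX b Y bY) Da.
  exists e; apply/funext => Y; rewrite oX; exact: oe.
apply: (exact_inner L_lifts_A bX (e := e)) => Y.
have o : omni_pairing X Y = w Y := esym (oX Y).
by rewrite o we.
Qed.

Lemma realizes_class D D' w w' : realizes D w -> realizes D' w' ->
  Ext_class D = Ext_class D' <-> H1_class w = H1_class w'.
Proof.
move=> Dw Dw'; have := realizes_exact (realizes_comb (-1) Dw' Dw).
rewrite !scaleN1r ![- _ + _]addrC => H.
split=> e; first exact: (qproj_eq (B1_subspace L) _ _).2 (H.1 ((qproj_eq (Inn_subspace A) _ _).1 e)).
exact: (qproj_eq (Inn_subspace A) _ _).2 (H.2 ((qproj_eq (B1_subspace L) _ _).1 e)).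
Qed.

End realizes.

Theorem corollary6p3 (R : realType) (n : nat) (M : manifold R n)
    (k : nat) (k_gt0 : (0 < k)%N) (E : vector_bundle M k)
    (r : nat) (r_gt0 : (0 < r)%N) (A : projective_algebroid E r)
    (L : dirac E) (L_lifts_A : is_lifted_dirac A L) :
  exists i : {linear Ext A -> H1 L},
    injective i /\
    forall D : Der A,
      (exists X : gamma (omni E), normalizer L X /\
         (forall a : sgamma A, falling X a = D a)) /\
      (forall X : gamma (omni E), normalizer L X ->
         (forall a : sgamma A, falling X a = D a) ->
         exists w : Z1 L, (forall Y : sgamma L, w Y = omega X Y) /\
                          i (Ext_class D) = H1_class w).
Proof.
have real_ex (D : Der A) : exists X, normalizer L X /\ forall a (Y : gamma (omni E)),
    bmap Y = sgamma_val a -> bmap (omni_bracket X Y) = D a.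
  have [X bX] := der_realization r_gt0 D; exists X; split=> //.
  exact: der_normalizer L_lifts_A _ _ bX.
have /choice[w wP] (D : Der A) : exists w : Z1 L, realizes D w.
  by have [X [NX bX]] := real_ex D; exists (omega_Z1 NX), X.
pose i (q : Ext A) : H1 L := H1_class (w (qrepr q)).
(* Removes both arbitrary choices, of a representative of the class and of X; linearity and the
   formula for an arbitrary X follow from it. *)
have iE D v : realizes D v -> i (Ext_class D) = H1_class v.
  move=> Dv; apply/(realizes_class r_gt0 L_lifts_A (wP _) Dv).
  exact: qreprK.
have i_lin : linear i.
  move=> t q q'.
  have Hq : t *: q + q' = Ext_class (t *: qrepr q + qrepr q' : Der A).
    by rewrite /Ext_class qprojD qprojZ !qreprK.
  rewrite Hq (iE _ _ (realizes_comb t (wP (qrepr q)) (wP (qrepr q')))).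
  by rewrite /i /H1_class qprojD qprojZ.
exists (HB.pack_for {linear Ext A -> H1 L} i (GRing.isLinear.Build _ _ _ _ i i_lin)).
split=> [q q' /= /(realizes_class r_gt0 L_lifts_A (wP _) (wP _)).2|D].
  by rewrite /Ext_class !qreprK.
split=> [|X NX FX].
  have [X [NX bX]] := real_ex D; exists X; split=> //.
  exact/(falling_bmap L_lifts_A).
exists (omega_Z1 NX); split=> //=; apply: iE; exists X; split=> //.
exact/(falling_bmap L_lifts_A).
Qed.
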